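(* Let $k\geq 2$ and $m\geq 2$ be integers. (a) The symplectic group $\mathrm{Sp}(2m,\mathbb{F}_{2^k})$ is a string C-group of rank $n$ for each $3\leq n\leq 2m+1$. (b) The orthogonal groups $\mathrm{O}^{+}(2m,\mathbb{F}_{2^k})$ and $\mathrm{O}^{-}(2m,\mathbb{F}_{2^k})$ are string C-groups of rank $n$ for each $3\leq n\leq 2m$.
   Context: A pair $(G;\{\rho_0,\ldots,\rho_{n-1}\})$, where $G$ is a group and $\rho_0,\ldots,\rho_{n-1}$ is an ordered sequence of elements of $G$, is a string group generated by involutions (sggi) if $G=\langle\rho_0,\ldots,\rho_{n-1}\rangle$, each $\rho_i$ is an involution (an element of order exactly 2), and the commuting property holds: for all $i,j\in\{0,\ldots,n-1\}$ with $|i-j|>1$, $(\rho_i\rho_j)^2=1$. An sggi is a string C-group, of rank $n$, if it also satisfies the intersection property: for all $I,J\subseteq\{0,\ldots,n-1\}$, $\langle\rho_i\mid i\in I\rangle\cap\langle\rho_j\mid j\in J\rangle=\langle\rho_k\mid k\in I\cap J\rangle$. Saying that a group $G$ ''is a string C-group of rank $n$'' means that there exist $\rho_0,\ldots,\rho_{n-1}\in G$ such that $(G;\{\rho_0,\ldots,\rho_{n-1}\})$ is a string C-group of rank $n$. $\mathbb{F}_{2^k}$ is the field with $2^k$ elements. $\mathrm{Sp}(2m,\mathbb{F}_{2^k})$ is the group of isometries of a nondegenerate alternating bilinear form on $\mathbb{F}_{2^k}^{2m}$. $\mathrm{O}^{+}(2m,\mathbb{F}_{2^k})$ (respectively $\mathrm{O}^{-}(2m,\mathbb{F}_{2^k})$)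 is the full isometry group of a quadratic form on $\mathbb{F}_{2^k}^{2m}$ whose polar form is nondegenerate and whose Witt index is $m$ (respectively $m-1$). *)

(* Defs.v *)
From HB Require Import structures.
From mathcomp Require Import all_boot all_order all_fingroup all_algebra.

Set Implicit Arguments.
Unset Strict Implicit.
Unset Printing Implicit Defensive.

Import GRing.Theory.
Local Open Scope ring_scope.

Section StringCGroup.
Local Open Scope group_scope.
Variables (gT : finGroupType) (n : nat).
Implicit Types (G : {group gT}) (rho : 'I_n -> gT).

Definition sggi G rho : Prop :=
  [/\ <<rho @: [set: 'I_n]>> = G,
      forall i, #[rho i] = 2
    & forall i j : 'I_n, (i.+1 < j)%N || (j.+1 < i)%N ->
        (rho i * rho j) ^+ 2 = 1].

Definition intersection_property rho : Prop :=
  forall I J : {set 'I_n},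
    <<rho @: I>> :&: <<rho @: J>> = <<rho @: (I :&: J)>>.

Definition string_C_group G rho : Prop :=
  sggi G rho /\ intersection_property rho.

End StringCGroup.

Definition is_string_C_group_of_rank (gT : finGroupType) (G : {group gT})
    (n : nat) : Prop :=
  exists rho : 'I_n -> gT, string_C_group G rho.

(* As {'GL_n[F]} consists of matrices of size n.-1.+1, the natural module is
   'rV[F]_n.-1.+1, which has dimension n only for n > 0. Matrices act on row
   vectors from the right. *)
Section IsometryGroups.
Variables (F : finFieldType) (n : nat).
Local Notation V := 'rV[F]_n.-1.+1.

Section Symplectic.
Variable B : V -> V -> F.

Definition bilinear_isometries : {set {'GL_n[F]}} :=
  [set g | [forall u : V, forall v : V,
    B (u *m GLval g) (v *m GLval g) == B u v]].

Lemma bilinear_isometries_group_set : group_set bilinear_isometries.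
Proof.
apply/group_setP; split=> [|g h].
  by rewrite inE; apply/forallP=> u; apply/forallP=> v; rewrite GL_1E !mulmx1.
rewrite !inE => /forallP Bg /forallP Bh.
apply/forallP=> u; apply/forallP=> v; rewrite GL_MxE !mulmxA.
have /forallP/(_ (v *m GLval g))/eqP -> := Bh (u *m GLval g).
by have /forallP/(_ v) := Bg u.
Qed.

Canonical bilinear_isometries_group := Group bilinear_isometries_group_set.

End Symplectic.

Section Orthogonal.
Variable Q : V -> F.

Definition polar (u v : V) : F := Q (u + v) - Q u - Q v.

Definition is_quadratic_form : Prop :=
  (forall (a : F) (v : V), Q (a *: v) = a ^+ 2 * Q v) /\
  (exists B : {biscalar V}, polar =2 B).

Definition polar_nondegenerate : Prop :=
  exists2 B : {symmetric V}, polar =2 B & nondegenerate B.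

(* The largest dimension of a totally singular subspace, with subspaces given
   as row spaces of square matrices. *)
Definition witt_index : nat :=
  \max_(A : 'M[F]_n.-1.+1 | [forall v : V, (v <= A)%MS ==> (Q v == 0)])
     \rank A.

Definition quadratic_isometries : {set {'GL_n[F]}} :=
  [set g | [forall v : V, Q (v *m GLval g) == Q v]].

Lemma quadratic_isometries_group_set : group_set quadratic_isometries.
Proof.
apply/group_setP; split=> [|g h].
  by rewrite inE; apply/forallP=> v; rewrite GL_1E mulmx1.
rewrite !inE => /forallP Qg /forallP Qh.
apply/forallP=> v; rewrite GL_MxE mulmxA.
by rewrite (eqP (Qh (v *m GLval g))) Qg.
Qed.

Canonical quadratic_isometries_group := Group quadratic_isometries_group_set.

End Orthogonal.

End IsometryGroups.

(* Main.v *)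
Require Import Defs.
From HB Require Import structures.
From mathcomp Require Import all_boot all_order all_fingroup all_algebra.
From mathcomp Require Import all_solvable all_field zify ring.

Set Implicit Arguments.
Unset Strict Implicit.
Unset Printing Implicit Defensive.

(** Write q for the order of F, which is even and at least 4. In the symplectic
   group of an alternating form B, let t_x be the transvection y |-> y + B(y,x) x;
   when Q is a quadratic form with polar form B and Q(x) = 1, t_x is a reflection of
   Q. Two transvections t_x, t_y commute exactly when x and y are orthogonal. The
   generators of the representations of maximal rank are such transvections.

   Orthogonal groups, rank 2m. Choose a basis v_0, ..., v_{2m-1} with Q(v_i) = 1
   that is a path for B: B(v_i,v_j) is 0 unless |i-j| <= 1, and B(v_i,v_{i+1}) <> 0.
   The generators are the reflections t_{v_i}. For an interval I let U_I be the span
   of the v_i with i in I, and R_I the group of the isometries that fix every dual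
   basis vector w_j with j outside I. Plainly R_I and R_J meet in R_K, where K is
   the intersection of I and J. So the intersection property is clear wherever the
   generators indexed by I generate the whole of R_I, that is, wherever I is full.
   R_I is generated by the reflections in vectors of U_I (generated_of_fixes, a form
   of the Cartan-Dieudonne theorem), hence I is full as soon as the generators of I
   produce all the reflections of U_I. For two consecutive vectors this holds if
   B(v_i,v_{i+1}) is a good parameter: the product of the two reflections has order
   q+1, the number of vectors of the anisotropic plane where Q is 1
   (pair_reflections). A third vector with an arbitrary nonzero link may then be
   added (triple_reflections), and from length 4 on an interval is full when its two
   maximal proper subintervals are (full_step). The intersections that matter are
   indexed by intervals without the first and the last index, so the first and the
   last link of the path are free. This leaves room for Q to be of either type:
   exists_path builds the path from a symplectic frame on which Q has suitable
   values.

   Symplectic group, rank 2m+1. Choose Q and a path basis as above with all its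
   links equal to one good parameter, and add one more vector v_{2m}, proportional
   to w_{2m-1}, with Q(v_{2m}) <> 1. The first 2m transvections generate O(Q). The
   last 2m generate O(Q') for the form Q'(x) = Q(x) + B(x,z)^2, where z is the
   multiple of w_0 for which Q' is 1 on v_1, ..., v_{2m}. An element of both groups
   fixes z, hence w_0, so it is in the group generated by the generators 1, ...,
   2m-1. Any nonzero x has the same Q-value as some x' with Q'(x') = 1 (unless
   already Q(x) = 1), and O(Q) is transitive on the nonzero vectors with a given
   value; so O(Q) and O(Q') together produce all the transvections, which generate
   Sp.

   Two facts on abstract groups finish the proof. The intersection property for all
   pairs of subsets follows from the case of the two maximal subintervals of each
   interval (intersection_of_intervals). And the rank can be lowered one by one down
   to 3 (rank_reduction): replace r_0, r_1, r_2, r_3, ... by r_1, r_0 r_2, r_3, ...;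
   as r_2 r_3 has odd order, r_0 is a power of (r_0 r_2) r_3. The product of two
   noncommuting transvections t_x, t_y always has odd order (odd_order_tvM). *)

(* Keeping only the arithmetic hypotheses makes lia fast in long contexts. *)
Ltac nlia := repeat match goal with H : ?T |- _ => lazymatch T with
  | is_true (leq _ _) => fail | is_true (andb _ _) => fail | is_true (orb _ _) => fail
  | is_true (~~ (_ == _)) => fail | @eq nat _ _ => fail | nat => fail
  | Equality.sort _ => fail
  | _ => clear H end end; lia.

(** * Intersection property of groups generated by a sequence *)
Section StringGroups.
Local Open Scope group_scope.
Variables (gT : finGroupType) (N : nat).
Implicit Types (r : nat -> gT) (P Q A B : pred nat).

(** Locked, since simplification would otherwise expose the generated set. *)
Definition gen_by r P : {group gT} :=
  locked <<[set r (i : 'I_N) | i in [pred i : 'I_N | P i]]>>%G.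

Lemma gen_byE r P :
  gen_by r P = <<[set r (i : 'I_N) | i in [pred i : 'I_N | P i]]>>%G.
Proof. by rewrite /gen_by -lock. Qed.

Definition itv a b : pred nat := fun i => (a <= i < b)%N.

Definition interval_property r :=
  forall a b, (a.+2 <= b <= N)%N ->
    gen_by r (itv a b.-1) :&: gen_by r (itv a.+1 b)
      \subset gen_by r (itv a.+1 b.-1).

Definition far_commute r :=
  forall i j, (i < N)%N -> (j < N)%N -> (i.+1 < j)%N -> commute (r i) (r j).

Lemma mem_gen_by r P i : (i < N)%N -> P i -> r i \in gen_by r P.
Proof.
move=> ltiN Pi; rewrite gen_byE; apply: mem_gen; apply/imsetP.
by exists (Ordinal ltiN).
Qed.

Lemma gen_by_subP r P (G : {group gT}) :
  reflect (forall i, (i < N)%N -> P i -> r i \in G) (gen_by r P \subset G).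
Proof.
rewrite gen_byE gen_subG; apply: (iffP subsetP) => [sPG i ltiN Pi | sPG x].
  by apply: sPG; apply/imsetP; exists (Ordinal ltiN).
by case/imsetP=> i Pi ->; apply: sPG.
Qed.

Lemma gen_byS r P Q :
  (forall i, (i < N)%N -> P i -> Q i) -> gen_by r P \subset gen_by r Q.
Proof.
by move=> sPQ; apply/gen_by_subP=> i ltiN Pi; apply: mem_gen_by (sPQ _ _ Pi).
Qed.

Lemma mem_gen_byS r P Q x : x \in gen_by r P ->
  (forall i, (i < N)%N -> P i -> Q i) -> x \in gen_by r Q.
Proof. by move=> Px sPQ; apply: subsetP Px; apply: gen_byS. Qed.

Lemma gen_by_pred0 r P x :
  (forall i, (i < N)%N -> ~~ P i) -> x \in gen_by r P -> x = 1.
Proof.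
move=> P0 Px; apply/set1P; move: x Px; apply/subsetP/(@gen_by_subP _ _ 1%G).
by move=> i ltiN; rewrite (negPf (P0 i ltiN)).
Qed.

Lemma eq_gen_by r r' P Q : (forall i, (i < N)%N -> P i = Q i) ->
  (forall i, (i < N)%N -> P i -> r i = r' i) -> gen_by r P = gen_by r' Q.
Proof.
move=> ePQ er; apply/group_inj/eqP; rewrite eqEsubset; apply/andP; split.
  apply/gen_by_subP=> i ltiN Pi; rewrite er //; apply: mem_gen_by => //.
  by rewrite -ePQ.
apply/gen_by_subP=> i ltiN Qi; rewrite -er ?ePQ //; apply: mem_gen_by => //.
by rewrite ePQ.
Qed.

(** Parts at distance at least two commute, so the group is their product. *)
Lemma gen_by_factor r P A B x : far_commute r ->
    (forall i, (i < N)%N -> P i -> A i || B i) ->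
    (forall i j, (i < N)%N -> (j < N)%N -> P i -> P j -> A i -> B j ->
       (i.+1 < j)%N) ->
    x \in gen_by r P ->
  exists y z, [/\ y \in gen_by r (predI P A), z \in gen_by r (predI P B)
                & x = y * z].
Proof.
move=> cr PAB AB Px.
have cAB : gen_by r (predI P B) \subset 'C(gen_by r (predI P A)).
  apply/gen_by_subP=> j ltjN /andP[Pj Bj]; rewrite -sub_cent1.
  apply/gen_by_subP=> i ltiN /andP[Pi Ai]; apply/cent1P.
  by apply: cr => //; apply: AB.
have: x \in gen_by r (predI P A) * gen_by r (predI P B).
  rewrite -cent_joinEr //; move: x Px; apply/subsetP/gen_by_subP=> i ltiN Pi.
  have [Ai|Bi] := orP (PAB i ltiN Pi).
    by apply: (subsetP (joing_subl _ _)); apply: mem_gen_by; rewrite //= Pi.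
  by apply: (subsetP (joing_subr _ _)); apply: mem_gen_by; rewrite //= Pi.
by case/mulsgP=> y z Py Pz ->; exists y, z.
Qed.

(** Moving the outer ends of the two intervals inwards, one step at a time, reduces
   to the case of two maximal subintervals of an interval. *)
Lemma interval_intersection r a b c d x : interval_property r ->
    (a <= c)%N -> (b <= d)%N -> (d <= N)%N ->
    x \in gen_by r (itv a b) -> x \in gen_by r (itv c d) ->
  x \in gen_by r (itv c b).
Proof.
move=> ipr; have [n] := ubnP ((c - a) + (d - b))%N.
elim: n a b c d => // n IHn a b c d ltn leac lebd ledN xab xcd.
have [lt_ac | ] := ltnP a c; last first.
  by move=> leca; have -> : c = a by nlia.
have [lt_bd | ] := ltnP b d; last first.
  by move=> ledb; have -> : b = d by nlia.
have [lt_da | le_ad] := ltnP d a.+2.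
  rewrite (gen_by_pred0 _ xcd) ?group1 // => i ltiN; rewrite /itv; nlia.
have xad : x \in gen_by r (itv a.+1 d.-1).
  apply: (subsetP (ipr a d _)); first by rewrite le_ad.
  rewrite inE; apply/andP; split.
    by apply: (mem_gen_byS xab) => i _; rewrite /itv; nlia.
  apply: (mem_gen_byS xcd) => i _; rewrite /itv; nlia.
apply: (IHn a.+1 b c d) => //; first nlia.
by apply: (IHn a b a.+1 d.-1) => //; nlia.
Qed.

(** The inductive criterion of McMullen and Schulte. If P misses i and Q misses j,
   with i <= j, an element x of both groups is x1 x2 with x1 from P below i, x2 from
   P above i, and y1 y2 with y1 from Q below j, y2 from Q above j. Then
   z = x1^-1 y1 = x2 y2^-1 comes from the indices strictly between i and j, and
   x = x1 z y2; induction on shorter intervals, applied to y1 = x1 z and to x2 = z y2,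
   shows that each of the three factors is generated by P and by Q. *)
Lemma intersection_of_intervals r P Q : interval_property r -> far_commute r ->
  gen_by r P :&: gen_by r Q \subset gen_by r (predI P Q).
Proof.
move=> ipr cr.
have intI := interval_intersection ipr.
suff IP n a b P' Q' x : (b - a < n)%N -> (b <= N)%N ->
    (forall i, (i < N)%N -> P' i -> itv a b i) ->
    (forall i, (i < N)%N -> Q' i -> itv a b i) ->
    x \in gen_by r P' -> x \in gen_by r Q' -> x \in gen_by r (predI P' Q').
- apply/subsetP=> x /setIP[Px Qx].
  by apply: (IP N.+1 0%N N); rewrite // /itv; nlia.
elim: n a b P' Q' x => // n IHn a b {}P {}Q.
suff IPij P' Q' x i j : (b - a < n.+1)%N -> (b <= N)%N ->
    (forall i, (i < N)%N -> P' i -> itv a b i) ->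
    (forall i, (i < N)%N -> Q' i -> itv a b i) ->
    x \in gen_by r P' -> x \in gen_by r Q' ->
    (a <= i)%N -> (i <= j)%N -> (j < b)%N -> ~~ P' i -> ~~ Q' j ->
    x \in gen_by r (predI P' Q').
- move=> x ltn lebN sP sQ Px Qx.
  have [/hasP[i] | /hasPn allP] := boolP (has (predC P) (iota a (b - a))); last first.
    apply: (mem_gen_byS Qx) => k ltk Qk /=; rewrite Qk andbT.
    have := allP k; rewrite mem_iota /= negbK; apply; have := sQ k ltk Qk.
    by rewrite /itv; nlia.
  rewrite mem_iota => Ii nPi.
  have [/hasP[j] | /hasPn allQ] := boolP (has (predC Q) (iota a (b - a))); last first.
    apply: (mem_gen_byS Px) => k ltk Pk /=; rewrite Pk /=.
    have := allQ k; rewrite mem_iota /= negbK; apply; have := sP k ltk Pk.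
    by rewrite /itv; nlia.
  rewrite mem_iota => Ij nQj.
  have [leij | ltji] := leqP i j.
    by apply: (IPij P Q x i j) => //; nlia.
  have: x \in gen_by r (predI Q P) by apply: (IPij Q P x j i) => //; nlia.
  by apply/subsetP/gen_byS=> k _ /=; rewrite andbC.
move=> ltn lebN sP sQ Px Qx leai leij ltjb nPi nQj.
have [x1 [x2 [Px1 Px2 def_x]]] : exists x1 x2, [/\
    x1 \in gen_by r (predI P' (itv a i)), x2 \in gen_by r (predI P' (itv i.+1 b))
    & x = x1 * x2].
  apply: gen_by_factor => // [k ltk Pk | k l _ _ _ _]; last by rewrite /itv; nlia.
  have: k != i by apply: contraNneq nPi => <-.
  by have := sP k ltk Pk; rewrite /itv; nlia.
have [y1 [y2 [Qy1 Qy2 def_y]]] : exists y1 y2, [/\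
    y1 \in gen_by r (predI Q' (itv a j)), y2 \in gen_by r (predI Q' (itv j.+1 b))
    & x = y1 * y2].
  apply: gen_by_factor => // [k ltk Qk | k l _ _ _ _]; last by rewrite /itv; nlia.
  have: k != j by apply: contraNneq nQj => <-.
  by have := sQ k ltk Qk; rewrite /itv; nlia.
pose z := x1^-1 * y1.
have def_z : z = x2 * y2^-1.
  by apply: (mulIg y2); rewrite mulgKV /z -mulgA -def_y def_x mulKg.
have zij : z \in gen_by r (itv i.+1 j).
  apply: (intI a j i.+1 b) => //; try nlia.
    rewrite groupM ?groupV //.
      apply: (mem_gen_byS Px1) => k _ /andP[_]; rewrite /itv; nlia.
    by apply: (mem_gen_byS Qy1) => k _ /andP[_].
  rewrite def_z groupM ?groupV //.
    by apply: (mem_gen_byS Px2) => k _ /andP[_].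
  apply: (mem_gen_byS Qy2) => k _ /andP[_]; rewrite /itv; nlia.
(* Below j: the factorization of y1 over the parts below i and above i is unique. *)
have [Qx1 Qz] : x1 \in gen_by r (predI (predI P' Q') (itv a i)) /\
                z \in gen_by r (predI Q' (itv i.+1 j)).
  pose P1 := predU (predI P' (itv a i)) (itv i.+1 j).
  have: y1 \in gen_by r (predI P1 (predI Q' (itv a j))).
    apply: (IHn a j) => //; try nlia.
    - by move=> k _ /orP[/andP[_]|]; rewrite /itv; nlia.
    - by move=> k _ /andP[_].
    have -> : y1 = x1 * z by rewrite mulKVg.
    rewrite groupM //.
      by apply: (mem_gen_byS Px1) => k _; rewrite /P1 /= => ->.
    by apply: (mem_gen_byS zij) => k _; rewrite /P1 /= => ->; rewrite orbT.
  case/(@gen_by_factor r _ (itv a i) (itv i.+1 j)) => //.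
  - by move=> k _ /andP[/orP[/andP[_ ->]|->]]; rewrite ?orbT.
  - by move=> k l _ _ _ _; rewrite /itv; nlia.
  move=> y1' [z' [Py1' Qz' def_y1]].
  have e1 : y1'^-1 * x1 = z' * z^-1.
    by apply: (mulIg z); rewrite mulgKV -mulgA /z mulKVg def_y1 mulKg.
  have ey : y1'^-1 * x1 = 1.
    apply: (@gen_by_pred0 r (itv i.+1 i)) => [k _|]; first by rewrite /itv; nlia.
    apply: (intI a i i.+1 j) => //; try nlia.
      rewrite groupM ?groupV //.
        by apply: subsetP Py1'; apply: gen_byS => k _ /andP[].
      by apply: (mem_gen_byS Px1) => k _ /andP[_].
    rewrite e1 groupM ?groupV //.
    by apply: subsetP Qz'; apply: gen_byS => k _ /andP[].
  have <- : y1' = x1 by apply: (mulgI y1'^-1); rewrite mulVg ey.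
  have <- : z' = z by apply/eqP; rewrite eq_mulgV1 -e1 ey.
  split.
    apply: subsetP Py1'; apply: gen_byS => k _; rewrite /P1 /= /itv; nlia.
  apply: subsetP Qz'; apply: gen_byS => k _; rewrite /P1 /= /itv; nlia.
(* The mirror image of the previous step, above i. *)
have [Py2 Pz] : y2 \in gen_by r (predI (predI P' Q') (itv j.+1 b)) /\
                z \in gen_by r (predI P' (itv i.+1 j)).
  pose P1 := predU (predI Q' (itv j.+1 b)) (itv i.+1 j).
  have ex2 : x2 = z * y2 by rewrite def_z mulgKV.
  have: x2 \in gen_by r (predI P1 (predI P' (itv i.+1 b))).
    apply: (IHn i.+1 b) => //; try nlia.
    - by move=> k _ /orP[/andP[_]|]; rewrite /itv; nlia.
    - by move=> k _ /andP[_].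
    rewrite ex2 groupM //.
      by apply: (mem_gen_byS zij) => k _; rewrite /P1 /= => ->; rewrite orbT.
    by apply: (mem_gen_byS Qy2) => k _; rewrite /P1 /= => ->.
  case/(@gen_by_factor r _ (itv i.+1 j) (itv j.+1 b)) => //.
  - by move=> k _ /andP[/orP[/andP[_ ->]|->]]; rewrite ?orbT.
  - by move=> k l _ _ _ _; rewrite /itv; nlia.
  move=> z' [y2' [Pz' Py2' def_x2]].
  have e1 : z'^-1 * z = y2' * y2^-1.
    by apply: (mulIg y2); rewrite mulgKV -mulgA -ex2 def_x2 mulKg.
  have ey : z'^-1 * z = 1.
    apply: (@gen_by_pred0 r (itv j.+1 j)) => [k _|]; first by rewrite /itv; nlia.
    apply: (intI i.+1 j j.+1 b) => //; try nlia.
      rewrite groupM ?groupV //.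
      by apply: subsetP Pz'; apply: gen_byS => k _ /andP[].
    rewrite e1 groupM ?groupV //.
      by apply: subsetP Py2'; apply: gen_byS => k _ /andP[].
    by apply: (mem_gen_byS Qy2) => k _ /andP[].
  have <- : z' = z by apply: (mulgI z'^-1); rewrite mulVg ey.
  have <- : y2' = y2 by apply/eqP; rewrite eq_mulgV1 -e1 ey.
  split.
    apply: subsetP Py2'; apply: gen_byS => k _; rewrite /P1 /= /itv; nlia.
  apply: subsetP Pz'; apply: gen_byS => k _; rewrite /P1 /= /itv; nlia.
have PQz : z \in gen_by r (predI (predI P' (itv i.+1 j)) (predI Q' (itv i.+1 j))).
  by apply: (IHn i.+1 j) => //; try nlia; move=> k _ /andP[].
have -> : x = x1 * (z * y2) by rewrite def_y mulgA mulKVg.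
apply: groupM; last apply: groupM.
- by apply: (mem_gen_byS Qx1) => k _ /andP[].
- by apply: (mem_gen_byS PQz) => k _ /andP[/andP[Pk _] /andP[Qk _]]; rewrite /= Pk Qk.
by apply: (mem_gen_byS Py2) => k _ /andP[].
Qed.

End StringGroups.

Section ChangeRange.
Local Open Scope group_scope.
Variable gT : finGroupType.
Implicit Types (r : nat -> gT) (P : pred nat).

Lemma gen_by_widen M N r P : (M <= N)%N -> (forall i, (i < N)%N -> P i -> (i < M)%N) ->
  gen_by N r P = gen_by M r P.
Proof.
move=> leMN PM; apply/group_inj/eqP; rewrite eqEsubset.
apply/andP; split; apply/gen_by_subP=> i lti Pi; apply: mem_gen_by => //.
  exact: PM.
exact: leq_trans leMN.
Qed.

Lemma gen_by_shift N r a b : (0 < a)%N ->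
  gen_by N.+1 r (itv a b) = gen_by N (fun i => r i.+1) (itv a.-1 b.-1).
Proof.
move=> a0; apply/group_inj/eqP; rewrite eqEsubset.
apply/andP; split; apply/gen_by_subP=> [] i lti Pi.
  case: i lti Pi => [|i] lti Pi; first by move: Pi; rewrite /itv; nlia.
  by apply: (mem_gen_by (fun j => r j.+1)) => //; move: Pi; rewrite /itv; nlia.
by apply: mem_gen_by => //; move: Pi; rewrite /itv; nlia.
Qed.
End ChangeRange.

(** * Rank reduction *)
Section RankReduction.
Local Open Scope group_scope.
Variable gT : finGroupType.
Implicit Types (r : nat -> gT) (N : nat).

(** String C-groups, with what is needed to reduce the rank repeatedly: consecutive
   generators do not commute, and the products of consecutive generators
   from the index 2 on have odd order. Reduction shifts these indices by one, so the
   last condition is inherited. *)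
Definition linked_string N r :=
  [/\ forall i, (i < N)%N -> #[r i] = 2,
      far_commute N r,
      interval_property N r,
      forall i, (i.+1 < N)%N -> ~ commute (r i) (r i.+1)
    & forall i, (2 <= i)%N -> (i.+1 < N)%N -> odd #[r i * r i.+1]].

Definition merged r : nat -> gT :=
  fun i => if i == 0%N then r 1%N else if i == 1%N then r 0 * r 2 else r i.+1.

(** The index of the generator of merged r in which r i occurs. *)
Definition merged_index i := if i == 0%N then 1%N else i.-1.

Lemma involM (x : gT) : #[x] = 2 -> x * x = 1.
Proof. by move=> ox; have := expg_order x; rewrite ox expgS expg1. Qed.

Lemma involV (x : gT) : #[x] = 2 -> x^-1 = x.
Proof. by move/involM=> xx; apply/eqP; rewrite eq_invg_mul xx. Qed.

Lemma gen_by1 N r i x : (i < N)%N -> #[r i] = 2 ->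
  x \in gen_by N r (pred1 i) -> x = 1 \/ x = r i.
Proof.
move=> ltiN oi xi; have: x \in <[r i]>.
  move: x xi; apply/subsetP/gen_by_subP=> j _ /eqP->; exact: cycle_id.
by rewrite cycle2g // !inE => /orP[]/eqP->; [left|right].
Qed.

Lemma commute_conj (x y : gT) : x ^ y = x -> commute x y.
Proof. by move=> xy; apply/commgP/conjg_fixP. Qed.

(** As x commutes with y and z, x (y z) to the odd order of y z is x. *)
Lemma odd_order_in_merged (x y z : gT) (G : {group gT}) :
  commute x y -> commute x z -> #[x] = 2 -> odd #[y * z] ->
  x * y \in G -> z \in G -> x \in G.
Proof.
move=> cxy cxz ox oyz Gxy Gz.
have cx : commute x (y * z) by apply: commuteM.
have <- : (x * (y * z)) ^+ #[y * z] = x.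
  rewrite expgMn // expg_order mulg1 (divn_eq #[y * z] 2) modn2 oyz expgD expg1.
  by rewrite mulnC expgM -{1}ox expg_order expg1n mul1g.
by rewrite groupX // mulgA groupM.
Qed.

(** The half-way power of a rotation of even order in a dihedral group. *)
Lemma central_involution (x y : gT) : x * x = 1 -> y * y = 1 -> ~~ odd #[x * y] ->
  exists e, [/\ (x * y) ^+ e != 1, ((x * y) ^+ e) ^ x = (x * y) ^+ e
                & ((x * y) ^+ e) ^ y = (x * y) ^+ e].
Proof.
move=> xx yy; set g := x * y => evg; exists #[g]./2; set e := #[g]./2.
have og2 : #[g] = (e + e)%N by rewrite addnn -[LHS]odd_double_half (negPf evg).
have hh : g ^+ e * g ^+ e = 1 by rewrite -expgD -og2 expg_order.
have hV : g ^- e = g ^+ e by apply/eqP; rewrite eq_invg_mul hh.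
have xV : x^-1 = x by apply/eqP; rewrite eq_invg_mul xx.
have yV : y^-1 = y by apply/eqP; rewrite eq_invg_mul yy.
have gV : g^-1 = y * x by rewrite invMg xV yV.
split.
- apply/negP=> /eqP h1; have : (#[g] %| e)%N by rewrite order_dvdn h1.
  by move/dvdn_leq; have := order_gt0 g; nlia.
- rewrite conjXg -[RHS]hV -expgVn; congr (_ ^+ _).
  by rewrite conjgE xV gV !mulgA xx mul1g.
rewrite conjXg -[RHS]hV -expgVn; congr (_ ^+ _).
by rewrite conjgE yV gV -!mulgA yy mulg1.
Qed.

Section Merge.
Variables (N : nat) (r : nat -> gT).
Hypotheses (N4 : (4 <= N)%N) (rS : linked_string N r).
Let tau := merged r.

Let invol i : (i < N)%N -> #[r i] = 2. Proof. by case: rS => h *; apply: h. Qed.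
Let far : far_commute N r. Proof. by case: rS. Qed.
Let ipr : interval_property N r. Proof. by case: rS. Qed.
Let linked i : (i.+1 < N)%N -> ~ commute (r i) (r i.+1).
Proof. by case: rS => _ _ _ h *; apply: h. Qed.
Let oddr i : (2 <= i)%N -> (i.+1 < N)%N -> odd #[r i * r i.+1].
Proof. by case: rS => _ _ _ _ h *; apply: h. Qed.

Let c02 : commute (r 0) (r 2). Proof. by apply: far; nlia. Qed.

Lemma order_merged : #[r 0 * r 2] = 2.
Proof.
have [o0 o2] : #[r 0] = 2 /\ #[r 2] = 2 by split; apply: invol; nlia.
apply: nt_prime_order => //.
  by rewrite expgS expg1 {1}c02 -mulgA (mulgA (r 0)) involM // mul1g involM.
apply/eqP=> r02; apply: (@linked 2); first nlia.
have -> : r 2 = r 0 by rewrite -[r 0]involV //; apply/eqP; rewrite eq_sym eq_invg_mul r02.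
by apply: far; nlia.
Qed.

Lemma merged_sub P : gen_by N.-1 tau P \subset gen_by N r (P \o merged_index).
Proof.
apply/gen_by_subP=> -[|[|i]] lti Pi; rewrite /tau /merged /=.
- by apply: mem_gen_by => //; nlia.
- by apply: groupM; apply: mem_gen_by => //; nlia.
by apply: mem_gen_by => //; nlia.
Qed.

(** If P contains 1, it contains 2, so the group contains r 0 r 2 and r 3, hence r 0
   and r 2 separately. *)
Lemma sub_merged (P : pred nat) : (P 1%N -> P 2) ->
  gen_by N r (P \o merged_index) \subset gen_by N.-1 tau P.
Proof.
move=> P12.
have P1r0 : P 1%N -> r 0 \in gen_by N.-1 tau P.
  move=> P1; apply: (@odd_order_in_merged _ (r 2) (r 3)) => //.
  - by apply: far; nlia.
  - by apply: invol; nlia.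
  - by apply: oddr; nlia.
  - by apply: (mem_gen_by (i := 1%N) tau); rewrite //; nlia.
  by apply: (mem_gen_by (i := 2) tau); rewrite ?P12 //; nlia.
apply/gen_by_subP=> [] [|[|[|i]]] lti; rewrite /merged_index //= => Pi.
- by apply: (mem_gen_by (i := 0%N) tau); rewrite //; nlia.
- rewrite -(groupMl _ (P1r0 Pi)).
  by apply: (mem_gen_by (i := 1%N) tau); rewrite //; nlia.
by apply: (mem_gen_by (i := i.+2) tau); rewrite //; nlia.
Qed.

(** A power of the rotation is inverted by r 1; if it were an involution it would
   commute with r 1, as r 0 and r 2 do not. *)
Lemma merged_powers x : x \in <[r 1 * (r 0 * r 2)]> -> x <> r 0 /\ x <> r 2.
Proof.
case/cycleP=> k def_x.
have o1 : #[r 1] = 2 by apply: invol; nlia.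
have [o0 o2] : #[r 0] = 2 /\ #[r 2] = 2 by split; apply: invol; nlia.
have xV : x ^ r 1 = x^-1.
  rewrite def_x conjXg -expgVn; congr (_ ^+ _).
  by rewrite conjgE -mulgA mulKg !invMg (involV o1) (involV o0) (involV o2) c02.
split=> def; rewrite def involV // in xV; have := commute_conj xV.
  by apply: linked; nlia.
by move/commute_sym; apply: linked; nlia.
Qed.

(** The elements of this dihedral group are rotations, excluded by merged_powers,
   or a rotation times r 0 r 2; if the latter is one of r 0, r 2, the rotation is
   the other one. *)
Lemma merged_dihedral x : x \in gen_by N.-1 tau (itv 0 2) -> x <> r 0 /\ x <> r 2.
Proof.
have o1 : #[r 1] = 2 by apply: invol; nlia.
have [o0 o2] : #[r 0] = 2 /\ #[r 2] = 2 by split; apply: invol; nlia.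
set t := r 0 * r 2; set g := r 1 * t.
have tt : t * t = 1 by rewrite /t {1}c02 -mulgA (mulgA (r 0)) involM // mul1g involM.
have tV : t^-1 = t by apply/eqP; rewrite eq_invg_mul tt.
have nt : <[t]> \subset 'N(<[g]>).
  rewrite cycle_subG inE -cycleJ cycle_subG.
  by rewrite conjgE tV /g -(mulgA (r 1)) tt mulg1 -groupV invMg tV (involV o1) cycle_id.
move=> Dx; have: x \in <[g]> * <[t]>.
  rewrite -norm_joinEr //.
  move: x Dx; apply/subsetP/gen_by_subP=> [] [|[|i]] lti //.
    rewrite /tau /merged /= => _; have -> : r 1 = g * t by rewrite -mulgA tt mulg1.
    by rewrite groupM ?(subsetP (joing_subl _ _) _ (cycle_id _))
      ?(subsetP (joing_subr _ _) _ (cycle_id _)).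
  by move=> _; apply: (subsetP (joing_subr _ _)); apply: cycle_id.
case/mulsgP=> y z gy; rewrite cycle2g; last exact: order_merged.
rewrite !inE => /orP[]/eqP-> ->; first by rewrite mulg1; apply: merged_powers.
have [y0 y2] := merged_powers gy; split=> def.
  by apply: y2; apply: (mulIg t); rewrite def /t c02 mulgA involM // mul1g.
by apply: y0; apply: (mulIg t); rewrite def /t mulgA involM // mul1g.
Qed.

(** Upper and lower bounds by subgroups of the original group agree, except for the
   first three generators: there the bound is the Klein group of r 0 and r 2, in
   which only 1 and r 0 r 2 belong to the dihedral group generated by r 1 and r 0 r
   2. *)
Lemma merged_interval_property : interval_property N.-1 tau.
Proof.
move=> a b leabN.
have IP P Q := intersection_of_intervals P Q ipr far.
have upper : gen_by N.-1 tau (itv a b.-1) :&: gen_by N.-1 tau (itv a.+1 b)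
    \subset gen_by N r (itv a.+1 b.-1 \o merged_index).
  apply: subset_trans (setISS (merged_sub _) (merged_sub _)) _.
  apply: subset_trans (IP _ _) _; apply: gen_byS => i _.
  by rewrite /itv /=; nlia.
have [/andP[/eqP a0 /eqP b3] | ab] := boolP ((a == 0%N) && (b == 3)); last first.
  apply: subset_trans upper (sub_merged _); rewrite /itv.
  by clear -leabN ab; lia.
apply/subsetP=> x xab; have := subsetP upper x xab.
have /merged_dihedral[x0 x2] : x \in gen_by N.-1 tau (itv 0 2).
  by case/setIP: xab; rewrite a0 b3.
case/(@gen_by_factor _ N r _ (pred1 0%N) (pred1 2)) => //.
- by move=> [|[|[|i]]] _; rewrite a0 b3 //=.
- by move=> i j _ _ _ _ /eqP-> /eqP->.
move=> y [z [y0 z2 def_x]].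
have {}y0 : y = 1 \/ y = r 0.
  apply: (@gen_by1 N); rewrite ?invol //; try nlia.
  by apply: mem_gen_byS y0 _ => i _ /andP[].
have {}z2 : z = 1 \/ z = r 2.
  apply: (@gen_by1 N); rewrite ?invol //; try nlia.
  by apply: mem_gen_byS z2 _ => i _ /andP[].
case: y0 z2 def_x x0 x2 => -> [] ->; rewrite ?mulg1 ?mul1g => -> //.
move=> _ _; apply: (mem_gen_by (i := 1%N) tau); rewrite ?a0 ?b3 //; nlia.
Qed.

Lemma merged_linked_string : linked_string N.-1 tau.
Proof.
have o i : (i < N)%N -> #[r i] = 2 := @invol i.
have [o0 o1 o2] : [/\ #[r 0] = 2, #[r 1] = 2 & #[r 2] = 2] by split; apply: o; nlia.
split.
- move=> [|[|i]] lti //=; rewrite /tau /merged //=; last by apply: o; nlia.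
  exact: order_merged.
- move=> i [|[|j]] lti ltj ltij //; rewrite /tau /merged.
  case: i lti ltij => [|[|i]] lti ltij //=; try (by apply: far; nlia).
  by apply/commute_sym/commuteM; apply: commute_sym; apply: far; nlia.
- exact: merged_interval_property.
- move=> [|[|i]] lti; rewrite /tau /merged /=; last by apply: linked; nlia.
    (* If r 1 commutes with r 0 r 2, then w is in the groups of r 0, r 1 and of r 1,
       r 2, so it is 1 or r 1. *)
    move=> c1; pose w := r 0 * (r 0) ^ r 1.
    have def_w : w = r 2 * (r 2) ^ r 1.
      have e : (r 0 * r 2) ^ r 1 = r 0 * r 2 by apply/conjg_fixP/commgP/commute_sym.
      rewrite conjMg in e.
      rewrite /w; have -> : (r 0) ^ r 1 = r 0 * r 2 * (r 2) ^ r 1.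
        by apply: (mulIg ((r 2) ^ r 1)); rewrite {1}e -[RHS]mulgA -conjMg involM // conj1g mulg1.
      by rewrite !mulgA involM // mul1g.
    have: w = 1 \/ w = r 1.
      apply: (@gen_by1 N); rewrite ?o1 //; try nlia.
      have: w \in gen_by N r (pred2 0%N 1%N) :&: gen_by N r (pred2 1%N 2).
        rewrite inE {2}def_w /w !conjgE.
        by rewrite !groupM ?groupV //; apply: mem_gen_by; rewrite //=; nlia.
      move/(subsetP (intersection_of_intervals _ _ ipr far)) => h.
      by apply: (mem_gen_byS h) => i _ /=; nlia.
    rewrite /w => -[] e.
      apply: (@linked 0%N); first nlia; apply: commute_conj.
      by apply: (mulgI (r 0)); rewrite e involM.
    have r1 : r 1 = 1; last by rewrite r1 order1 in o1.
    have: r 0 * r 1 * r 0 = 1.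
      apply: (mulIg (r 1)); rewrite mul1g -[RHS]e conjgE involV // !mulgA.
      by [].
    move/(congr1 (fun x => r 0 * x * r 0)); rewrite !mulgA involM // mul1g.
    by rewrite -mulgA involM // !mulg1 involM.
  move=> c23; apply: (@linked 2); first nlia.
  have c03 : commute (r 0) (r 3) by apply: far; nlia.
  have -> : r 2 = r 0 * (r 0 * r 2) by rewrite mulgA involM // mul1g.
  by apply/commute_sym/commuteM; apply: commute_sym.
by move=> [|[|i]] lti ltiN //; apply: oddr; nlia.
Qed.

Lemma gen_by_merged : gen_by N.-1 tau predT = gen_by N r predT.
Proof.
apply/group_inj/eqP; rewrite eqEsubset.
by rewrite (subset_trans (merged_sub _)) ?(subset_trans _ (sub_merged _)) //;
  apply: gen_byS.
Qed.

End Merge.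

Lemma rank_reduction N r n : linked_string N r -> (3 <= n <= N)%N ->
  exists2 r', linked_string n r' & gen_by n r' predT = gen_by N r predT.
Proof.
elim: N r => [|N IHN] r rS /andP[n3 leN]; first nlia.
have [lenN | ltNn] := leqP n N; last first.
  have -> : n = N.+1 by nlia.
  by exists r.
have N4 : (4 <= N.+1)%N by nlia.
have [|r' r'S genr'] := IHN (merged r) (merged_linked_string N4 rS).
  by rewrite n3.
by exists r' => //; rewrite genr' -(gen_by_merged N4 rS).
Qed.

Lemma linked_string_C_group N r (G : {group gT}) :
  linked_string N r -> gen_by N r predT = G -> is_string_C_group_of_rank G N.
Proof.
case=> o far ipr _ _ <-; exists (fun i : 'I_N => r i); split; [split|].
- rewrite gen_byE; congr (<<_>>); apply/setP=> x.
  by apply/imsetP/imsetP=> -[i _ ->]; exists i; rewrite ?inE.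
- by move=> i; apply: o.
- move=> i j /orP[] lt; rewrite expgS expg1.
    rewrite {1}(far i j) // -mulgA (mulgA (r i)) involM ?o //.
    by rewrite mul1g involM ?o.
  rewrite -{1}(far j i) // -mulgA (mulgA (r i)) involM ?o //.
  by rewrite mul1g involM ?o.
have genE (I : {set 'I_N}) :
   <<(fun i : 'I_N => r i) @: I>> = gen_by N r (fun k => [exists i in I, val i == k]).
  rewrite gen_byE /=; congr (<<_>>); apply/setP=> x; apply/imsetP/imsetP=> -[i].
    by move=> Ii ->; exists i => //; apply/exists_inP; exists i.
  by case/exists_inP=> j Ij /eqP/val_inj<- ->; exists j.
move=> I J; rewrite !genE; apply/eqP; rewrite eqEsubset.
rewrite (subset_trans (intersection_of_intervals _ _ ipr far)) /=; last first.
  apply: gen_byS => k _ /andP[/exists_inP[i Ii /eqP<-] /exists_inP[j Jj /eqP/val_inj e]].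
  by apply/exists_inP; exists i; rewrite ?inE ?Ii -?e.
rewrite subsetI; apply/andP; split; apply: gen_byS => k _;
  case/exists_inP=> i; rewrite inE => /andP[Ii Ji] eik; by apply/exists_inP; exists i.
Qed.
End RankReduction.

(** * Finite fields of even order *)
Import GRing.Theory.
Local Open Scope ring_scope.

Lemma char2_trace_identity (K : fieldType) (z : K) : 2 = 0 :> K -> z != 0 ->
  z ^+ 2 + (z + z^-1) * z + 1 = 0.
Proof. by move=> h2 z0; rewrite mulrDl mulVf //; ring: h2. Qed.

Lemma char2_trace_factor (K : fieldType) (x z : K) : 2 = 0 :> K -> z != 0 ->
  (x + z) * (x + z^-1) = x ^+ 2 + (z + z^-1) * x + 1.
Proof. by move=> h2 z0; field. Qed.

Section EvenField.
Variable F : finFieldType.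
Hypothesis ch2 : 2 \in [pchar F].
Hypothesis F4 : (3 < #|F|)%N.
Implicit Types x y z a b c : F.

Lemma two0 : 2 = 0 :> F. Proof. exact: pcharf0. Qed.

Lemma three1 : 3 = 1 :> F. Proof. by rewrite -[3%N]/(2 + 1)%N natrD two0 add0r. Qed.

Lemma sqr_inj : injective (fun x : F => x ^+ 2).
Proof. exact: (fmorph_inj (pFrobenius_aut ch2)). Qed.

Let oppF : forall x, - x = x := oppr_pchar2 ch2.

Definition char2_sqrt := invF sqr_inj.

Lemma char2_sqrtK x : char2_sqrt x ^+ 2 = x. Proof. exact: (f_invF sqr_inj). Qed.

Lemma char2_sqrt_eq0 x : (char2_sqrt x == 0) = (x == 0).
Proof. by rewrite -{2}(char2_sqrtK x) sqrf_eq0. Qed.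

(** The image of the Artin-Schreier map, the kernel of the absolute trace: it decides
   which quadratic polynomials have a root. *)
Definition AS : {set F} := [set x ^+ 2 + x | x : F].

Lemma ASP x : reflect (exists y, x = y ^+ 2 + y) (x \in AS).
Proof.
by apply: (iffP imsetP) => [[y _ ->]|[y ->]]; exists y.
Qed.

Lemma AS0 : 0 \in AS.
Proof. by apply/ASP; exists 0; rewrite expr0n addr0. Qed.

Lemma AS_add x y : x \in AS -> y \in AS -> x + y \in AS.
Proof.
move=> /ASP[u ->] /ASP[v ->]; apply/ASP; exists (u + v).
ring: two0.
Qed.

Lemma AS_addr x y : x \in AS -> (x + y \in AS) = (y \in AS).
Proof.
move=> xA; apply/idP/idP=> [xyA|]; last exact: AS_add.
have -> : y = x + (x + y) by ring: two0.
exact: AS_add.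
Qed.

Lemma AS_sqr x : (x ^+ 2 \in AS) = (x \in AS).
Proof.
have -> : x ^+ 2 = (x ^+ 2 + x) + x by ring: two0.
by rewrite AS_addr //; apply/ASP; exists x.
Qed.

Lemma card_AS : (#|AS| * 2)%N = #|F|.
Proof.
rewrite -sum_nat_const -[RHS]sum1_card.
rewrite [RHS](partition_big (fun x => x ^+ 2 + x) (mem AS)) /=; last first.
  by move=> x _; apply/ASP; exists x.
apply: eq_bigr => x /ASP[y def_x].
rewrite sum1_card; apply/esym; transitivity #|[set y; y + 1]|; last first.
  by rewrite cards2 -subr_eq0 opprD addrA subrr sub0r oppr_eq0 oner_eq0.
apply: eq_card => z; rewrite !inE def_x -[LHS]/(z ^+ 2 + z == y ^+ 2 + y) -subr_eq0.
have -> : z ^+ 2 + z - (y ^+ 2 + y) = (z - y) * (z - (y + 1)) by rewrite !oppF; ring: two0.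
by rewrite mulf_eq0 !subr_eq0.
Qed.

(** AS has index two. *)
Lemma AS_notin_add x y : x \notin AS -> y \notin AS -> x + y \in AS.
Proof.
move=> xA yA; pose A' := [set x + z | z in AS].
have cA' : #|A'| = #|AS| by apply: card_imset; apply: addrI.
have dA : [disjoint AS & A'].
  rewrite disjoint_subset; apply/subsetP=> z zA; rewrite !inE.
  apply/negP=> /imsetP[w wA def_z]; case/negP: xA.
  have -> : x = z + w by rewrite def_z; ring: two0.
  exact: AS_add.
have : y \in AS :|: A'.
  suff -> : AS :|: A' = [set: F] by rewrite inE.
  apply/eqP; rewrite eqEcard subsetT cardsT cardsU disjoint_setI0 // cards0.
  by rewrite cA' -card_AS; lia.
rewrite inE (negPf yA) => /imsetP[w wA ->].
by have -> : x + (x + w) = w by ring: two0.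
Qed.

Lemma AS_proper : exists x, x \notin AS.
Proof.
apply/existsP; rewrite -negb_forall; apply/negP=> /forallP AST.
have : #|AS| = #|F| by apply: eq_card => x; rewrite AST.
by have := card_AS; lia.
Qed.

Lemma quadratic_root b e : b != 0 -> e / b ^+ 2 \in AS ->
  exists x, x ^+ 2 + b * x + e = 0.
Proof.
move=> b0 /ASP[y ye]; exists (b * y).
have -> : e = b ^+ 2 * (y ^+ 2 + y) by rewrite -ye; field.
ring: two0.
Qed.

(** X^2 + X + d is irreducible for d outside AS. *)
Lemma quadratic_extension :
  exists (L : finFieldType) (iota : {rmorphism F -> L}), #|L| = (#|F| ^ 2)%N.
Proof.
have [d dA] := AS_proper.
pose p : {poly F} := 'X^2 + 'X + d%:P.
have szp : size p = 3.
  by rewrite /p -addrA size_polyDl size_polyXn // size_XaddC.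
have pM : p \is monic by rewrite /p -addrA monicE lead_coefDl ?lead_coefXn // size_polyXn size_XaddC.
have pI : irreducible_poly p.
  apply: cubic_irreducible; first by rewrite szp.
  move=> x; rewrite /root !hornerE; apply: contraNneq dA => px.
  apply/ASP; exists x; rewrite -[LHS]addr0 -px; ring: two0.
have hI : monic_irreducible_poly p by split.
exists {poly %/ p with hI}; exists (qpolyC p).
by rewrite card_qfpoly szp.
Qed.

(** For two vectors with Q(e0) = Q(e1) = 1 and B(e0,e1) = c, the plane is anisotropic
   since X^2 + c X + 1 has no root, and the product of the two reflections, with
   characteristic polynomial X^2 + c^2 X + 1 on this plane, has an eigenvalue z of order q+1. *)
Definition good_parameter (c : F) :=
  [/\ c != 0, c^-1 \notin AS
    & exists (L : fieldType) (iota : {rmorphism F -> L}) (z : L),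
      z ^+ 2 + iota c ^+ 2 * z + 1 = 0 /\
      forall k, z ^+ k = 1 -> (#|F|.+1 %| k)%N].

(** Take z of order q+1 in the multiplicative group of the quadratic extension. The
   Frobenius map inverts z, so z + 1/z is in F; c is its square root. *)
Lemma exists_good_parameter : exists c, good_parameter c.
Proof.
have [L [iota cardL]] := quadratic_extension.
have q1 : (1 < #|F|)%N by lia.
have /cyclicP[th th_gen] := field_unit_group_cyclic [set: {unit L}].
have oth : #[th]%g = (#|F| ^ 2).-1.
  by rewrite /order -th_gen card_finField_unit cardL.
pose z : {unit L} := (th ^+ #|F|.-1)%g.
have q2 : (#|F| ^ 2).-1 = (#|F|.-1 * #|F|.+1)%N by nia.
have oz k : (z ^+ k == 1)%g = (#|F|.+1 %| k)%N.
  by rewrite -order_dvdn /z orderXdiv oth q2 ?dvdn_mulr // mulKn //; lia.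
have zval k : (val z ^+ k == 1) = (#|F|.+1 %| k)%N.
  by rewrite -oz -FinRing.val_unitX -(inj_eq val_inj).
have ch2L : 2 \in [pchar L] by rewrite (fmorph_pchar iota).
have two0L : 2 = 0 :> L := pcharf0 ch2L.
have frobL (x y : L) : (x + y) ^+ #|F| = x ^+ #|F| + y ^+ #|F|.
  have [n oF] : exists n, #|F| = (2 ^ n)%N by exists (logn 2 #|F|); apply: card_pprimeChar ch2.
  by rewrite oF; elim: n {oF} => [|n IHn]; rewrite ?expr1 // expnS mulnC !exprM IHn -!(pFrobenius_autE ch2L) rmorphD.
have imF (x : L) : x ^+ #|F| = x -> exists y, x = iota y.
  move=> xq.
  have [/codomP[y]|xF] := boolP (x \in codom iota); first by exists y.
  pose P : {poly L} := 'X^#|F| - 'X.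
  have sP : size P = #|F|.+1 by rewrite size_polyDl size_polyXn // size_polyN size_polyX; lia.
  have P0 : P != 0 by rewrite -size_poly_eq0 sP.
  have: (size (x :: codom iota) < size P)%N.
    apply: max_poly_roots => //=.
      rewrite /root !hornerE xq subrr eqxx /=; apply/allP=> _ /codomP[y ->].
      by rewrite /root !hornerE -rmorphXn /= expf_card subrr.
    by rewrite xF /= map_inj_uniq ?enum_uniq //; apply: fmorph_inj.
  by rewrite /= size_codom sP ltnn.
have z0 : val z != 0 by rewrite -unitfE; apply: valP.
have zq : val z ^+ #|F| = (val z)^-1.
  by apply: (mulfI z0); rewrite -exprS divff //; apply/eqP; rewrite zval.
have [a def_a] : exists a, val z + (val z)^-1 = iota a.
  by apply: imF; rewrite frobL exprVn zq invrK addrC.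
have ozn k : val z ^+ k = 1 -> (#|F|.+1 %| k)%N by move/eqP; rewrite zval.
have zz : val z ^+ 2 + iota (char2_sqrt a) ^+ 2 * val z + 1 = 0.
  by rewrite -rmorphXn /= char2_sqrtK -def_a char2_trace_identity.
have z2 : val z ^+ 2 <> 1 by move/ozn/dvdn_leq; lia.
have zqz : val z ^+ #|F| <> val z.
  rewrite zq => zV; apply: z2; rewrite expr2 -{2}zV divff //.
have c0 : char2_sqrt a != 0.
  rewrite char2_sqrt_eq0; apply/eqP=> a0; rewrite a0 rmorph0 in def_a.
  apply: z2; apply/eqP; rewrite -subr_eq0 (oppr_pchar2 ch2L) -zz.
  by rewrite -rmorphXn /= char2_sqrtK a0 rmorph0 mul0r addr0.
exists (char2_sqrt a); split=> //; last by exists L, iota, (val z).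
apply/negP=> cA; have [|x x0] := @quadratic_root (char2_sqrt a) 1 c0.
  by rewrite div1r -exprVn AS_sqr.
pose w := iota (x ^+ 2).
have: (w - val z) * (w - (val z)^-1) = 0.
  have <- : iota ((x ^+ 2 + char2_sqrt a * x + 1) ^+ 2) = 0 by rewrite x0 expr0n rmorph0.
  rewrite !(oppr_pchar2 ch2L) char2_trace_factor // def_a /w.
  rewrite -{1}(char2_sqrtK a) -rmorphM -rmorphXn -rmorphD -(rmorph1 iota) -rmorphD /=.
  by congr (iota _); ring: two0.
move/eqP; rewrite mulf_eq0 !subr_eq0.
have wq : w ^+ #|F| = w by rewrite /w -rmorphXn /= expf_card.
case/orP=> /eqP wz; apply: zqz; first by rewrite -wz.
by rewrite zq -wz -wq wz exprVn zq invrK.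
Qed.

End EvenField.

(** * Transvections and reflections *)
Lemma exists_notin (T : finType) (s : seq T) :
  (size s < #|T|)%N -> exists t, t \notin s.
Proof.
move=> lts; apply/existsP; rewrite -negb_forall; apply: contraL lts => /forallP sT.
by rewrite -leqNgt cardE; apply: uniq_leq_size; rewrite ?enum_uniq.
Qed.

(** The group structure on GL is hidden behind a definition, so that unification
   does not unfold it into matrices. *)
Definition GLgroup (F : finFieldType) (n : nat) : finGroupType := {'GL_n[F]}.

Section Transvections.
Variables (F : finFieldType) (n : nat).
Hypothesis ch2 : 2 \in [pchar F].
Hypothesis F4 : (3 < #|F|)%N.
Local Notation V := 'rV[F]_n.-1.+1.
Local Notation GL := (GLgroup F n).
Variable B : V -> V -> F.

Definition nondegenerate_alternating :=
  [/\ forall a u v w, B (a *: u + v) w = a * B u w + B v w,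
      forall u v, B u v = B v u,
      forall u, B u u = 0
    & forall u, (forall v, B u v = 0) -> u = 0].

Hypothesis Bform : nondegenerate_alternating.

Let two0 : 2 = 0 :> F. Proof. exact: pcharf0. Qed.
Let three1 : 3 = 1 :> F. Proof. exact: three1. Qed.
Let oppF : forall x : F, - x = x := oppr_pchar2 ch2.

Lemma addvv (x : V) : x + x = 0.
Proof. by rewrite -mulr2n -scaler_nat two0 scale0r. Qed.

Lemma addvK (x y : V) : x + (x + y) = y. Proof. by rewrite addrA addvv add0r. Qed.

Lemma oppv (x : V) : - x = x.
Proof. by apply/eqP; rewrite eq_sym -subr_eq0 opprK addvv. Qed.

Lemma Bsym u v : B u v = B v u. Proof. by case: Bform. Qed.
Lemma Balt u : B u u = 0. Proof. by case: Bform. Qed.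
Lemma Bnd u : (forall v, B u v = 0) -> u = 0. Proof. by case: Bform => _ _ _; apply. Qed.
Lemma BDl u v w : B (u + v) w = B u w + B v w.
Proof. by case: Bform => /(_ 1 u v w); rewrite scale1r mul1r. Qed.
Lemma B0l w : B 0 w = 0.
Proof. by apply: (addIr (B 0 w)); rewrite -BDl !add0r. Qed.
Lemma BZl a u w : B (a *: u) w = a * B u w.
Proof. by case: Bform => /(_ a u 0 w); rewrite addr0 B0l addr0. Qed.
Lemma BDr u v w : B w (u + v) = B w u + B w v.
Proof. by rewrite Bsym BDl !(Bsym w). Qed.
Lemma BZr a u w : B w (a *: u) = a * B w u.
Proof. by rewrite Bsym BZl (Bsym w). Qed.
Lemma B0r w : B w 0 = 0. Proof. by rewrite Bsym B0l. Qed.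
Definition BE := (BDl, BZl, BDr, BZr).

Definition ap (y : V) (g : GL) : V := y *m GLval (g : {'GL_n[F]}).

Lemma ap1 y : ap y 1%g = y. Proof. exact: mulmx1. Qed.
Lemma apM y g h : ap y (g * h)%g = ap (ap y g) h.
Proof. exact: mulmxA. Qed.
Lemma apK g : cancel (ap^~ g) (ap^~ g^-1%g).
Proof. by move=> y; rewrite -apM mulgV ap1. Qed.
Lemma apVK g : cancel (ap^~ g^-1%g) (ap^~ g).
Proof. by move=> y; rewrite -apM mulVg ap1. Qed.
Lemma apD g x y : ap (x + y) g = ap x g + ap y g. Proof. exact: mulmxDl. Qed.
Lemma apZ g a x : ap (a *: x) g = a *: ap x g. Proof. by rewrite /ap -scalemxAl. Qed.

Lemma ap_inj g h : (forall y, ap y g = ap y h) -> g = h.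
Proof.
move=> gh; apply: val_inj; apply/row_matrixP=> i; rewrite !rowE.
exact: gh.
Qed.

Definition fixer_set (x : V) : {set GL} := [set g | ap x g == x].
Lemma fixer_group_set x : group_set (fixer_set x).
Proof.
apply/group_setP; split=> [|g h]; rewrite !inE ?ap1 // apM.
by move=> /eqP-> /eqP->.
Qed.
Canonical fixer x := Group (fixer_group_set x).

Lemma fixerP x g : reflect (ap x g = x) (g \in fixer x).
Proof. by rewrite inE; apply: eqP. Qed.

Definition symplectic_group : {group GL} := bilinear_isometries_group (n := n) B.
Local Notation Sp := symplectic_group.

Lemma SpP (g : GL) : reflect (forall u v, B (ap u g) (ap v g) = B u v) (g \in Sp).
Proof.
rewrite inE; apply: (iffP forallP) => [h u v|h u].
  by move: (h u) => /forallP/(_ v)/eqP.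
by apply/forallP=> v; apply/eqP; apply: h.
Qed.

Definition transvection_mx (x : V) : 'M[F]_n.-1.+1 :=
  1%:M + (\col_i B (delta_mx 0 i) x) *m x.

Lemma mul_transvection_mx y x : y *m transvection_mx x = y + B y x *: x.
Proof.
rewrite mulmxDr mulmx1 mulmxA; congr (_ + _).
have -> : y *m \col_i B (delta_mx 0 i) x = (B y x)%:M; last by rewrite mul_scalar_mx.
apply/matrixP=> i j; rewrite !ord1 !mxE eqxx mulr1n.
rewrite {2}(row_sum_delta y).
have BS (I : Type) (r : seq I) (f : I -> V) :
    B (\sum_(k <- r) f k) x = \sum_(k <- r) B (f k) x.
  by elim/big_rec2: _ => [|k a b _ <-]; rewrite ?B0l ?BDl.
by rewrite BS; apply: eq_bigr => k _; rewrite BZl mxE.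
Qed.

Lemma transvection_mxK x : transvection_mx x *m transvection_mx x = 1%:M.
Proof.
apply/row_matrixP=> i; rewrite !rowE mulmxA !mul_transvection_mx mulmx1.
by rewrite !BE Balt mulr0 addr0 -addrA addvv addr0.
Qed.

Definition tv x : GL := insubd (1%g : {'GL_n[F]}) (transvection_mx x).

Lemma tvE y x : ap y (tv x) = y + B y x *: x.
Proof.
rewrite /ap -[GLval _]/(val (tv x)) val_insubd.
have -> : transvection_mx x \is a GRing.unit by have [] := mulmx1_unit (transvection_mxK x).
exact: mul_transvection_mx.
Qed.

Lemma tv_invol x : (tv x * tv x)%g = 1%g.
Proof.
apply: ap_inj => y; rewrite apM !tvE ap1.
by rewrite !BE Balt mulr0 addr0 -addrA addvv addr0.
Qed.

Lemma tv_Sp x : tv x \in Sp.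
Proof. by apply/SpP=> u v; rewrite !tvE !BE Balt (Bsym x v); ring: two0. Qed.

Lemma tvJ x g : g \in Sp -> (tv x ^ g)%g = tv (ap x g).
Proof.
move=> /SpP gS; apply: ap_inj => y; rewrite conjgE !apM !tvE apD apZ apVK.
by rewrite -[in B _ x](gS) apVK.
Qed.

Lemma tvJ_mem (K : {group GL}) x g : K \subset Sp -> g \in K ->
  (tv (ap x g) \in K) = (tv x \in K).
Proof. by move=> sKS gK; rewrite -tvJ; [exact: groupJr | exact: (subsetP sKS)]. Qed.

Lemma tv_inj x y : tv x = tv y -> x = y.
Proof.
move=> txy; have e u : B u x *: x = B u y *: y.
  by apply: (addrI u); rewrite -!tvE txy.
have nz (u : V) : u != 0 -> exists u', B u' u != 0.
  move=> u0; apply/existsP; rewrite -negb_forall; apply: contra u0 => /forallP h.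
  by apply/eqP/Bnd => u'; rewrite Bsym; apply/eqP; apply: h.
have [x0|x0] := eqVneq x 0; last have [u ux] := nz x x0.
  have [-> //|/nz[u /eqP uy]] := eqVneq y 0.
  have := e u; rewrite x0 scaler0 => /esym/eqP; rewrite scaler_eq0 => /orP[/eqP//|/eqP->//].
have [l def_x] : exists l, x = l *: y.
  by exists (B u y / B u x); rewrite mulrC -scalerA -e scalerA mulVf // scale1r.
have uy : B u y != 0 by apply: contraNneq ux; rewrite def_x BZr => ->; rewrite mulr0.
have := congr1 (B u) (e u); rewrite !BZr def_x BZr => h.
have -> : l = 1; last by rewrite scale1r.
apply: (sqr_inj ch2); rewrite expr1n; apply: (mulfI (mulf_neq0 uy uy)).
by rewrite mulr1 -[RHS]h; ring.
Qed.

Lemma tv_commute x y : B x y = 0 -> commute (tv x) (tv y).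
Proof.
move=> xy; apply: ap_inj => u; rewrite !apM !tvE !BE xy (Bsym y x) xy !mulr0 !addr0.
by rewrite -!addrA [_ *: _ + _ *: _]addrC.
Qed.

Lemma tv_noncommute x y : B x y != 0 -> ~ commute (tv x) (tv y).
Proof.
move=> xy cxy; have := congr1 (ap x) cxy; rewrite !apM !tvE Balt scale0r addr0.
rewrite !BE Balt add0r (Bsym y x) => /eqP.
rewrite -[X in X == _]addr0 (inj_eq (addrI _)) eq_sym scaler_eq0 mulf_eq0 (negPf xy) /=.
by move=> /eqP x0; rewrite x0 B0l eqxx in xy.
Qed.

(** For an even order, a power h <> 1 of t_x t_y would be central in the dihedral
   group, so it would fix x and y. But v h - v is in the span of x and y and is
   orthogonal to both, hence it is 0. *)
Lemma odd_order_tvM x y : B x y != 0 -> odd #[tv x * tv y]%g.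
Proof.
move=> xy; apply: contraT => /(central_involution (tv_invol x) (tv_invol y)).
set g := (tv x * tv y)%g => -[e [h1 hx hy]].
have hS : (g ^+ e)%g \in Sp by apply: groupX; apply: groupM; apply: tv_Sp.
have {hx}hx : ap x (g ^+ e)%g = x.
  by apply: tv_inj; rewrite -tvJ //; apply/conjg_fixP/commgP/commute_sym/commgP/conjg_fixP.
have {hy}hy : ap y (g ^+ e)%g = y.
  by apply: tv_inj; rewrite -tvJ //; apply/conjg_fixP/commgP/commute_sym/commgP/conjg_fixP.
have span_g i u : exists a b, ap u (g ^+ i)%g = u + (a *: x + b *: y).
  elim: i => [|i [a [b IHi]]].
    by exists 0, 0; rewrite expg0 ap1 !scale0r !addr0.
  rewrite expgSr apM IHi /g apM !tvE.
  set c := B _ x; set d := B _ y; exists (a + c), (b + d).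
  by rewrite !scalerDl -!addrA; do 2!congr (_ + _); rewrite addrCA.
case/eqP: h1; apply: ap_inj => u; rewrite ap1; have [a [b hu]] := span_g e u.
have hB z : ap z (g ^+ e)%g = z -> B (a *: x + b *: y) z = 0.
  move=> hz; have := SpP _ hS u z; rewrite hz hu BDl => /eqP.
  by rewrite -[X in _ == X]addr0 (inj_eq (addrI _)) => /eqP.
move: (hB x hx) (hB y hy); rewrite !BE !Balt (Bsym y x) !mulr0 add0r addr0.
move=> /eqP; rewrite mulf_eq0 (negPf xy) orbF => /eqP b0.
move=> /eqP; rewrite mulf_eq0 (negPf xy) orbF => /eqP a0.
by rewrite hu a0 b0 !scale0r !addr0.
Qed.

Definition linear_set (A : V -> Prop) :=
  A 0 /\ forall a u v, A u -> A v -> A (a *: u + v).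

Lemma linear_setD A u v : linear_set A -> A u -> A v -> A (u + v).
Proof. by case=> _ Al Au Av; rewrite -[u]scale1r; apply: Al. Qed.

Lemma linear_setZ A a u : linear_set A -> A u -> A (a *: u).
Proof. by case=> A0 Al Au; rewrite -[_ *: _]addr0; apply: Al. Qed.

Lemma nonperp2 A w w' : linear_set A ->
    (exists2 x, A x & B w x != 0) -> (exists2 x, A x & B w' x != 0) ->
  exists x, [/\ A x, B w x != 0 & B w' x != 0].
Proof.
move=> Al [p Ap wp] [p' Ap' wp'].
have [w'p|w'p] := eqVneq (B w' p) 0; last by exists p.
have [wp'0|wp'0] := eqVneq (B w p') 0; last by exists p'.
by exists (p + p'); split; rewrite ?BDr ?w'p ?wp'0 ?addr0 ?add0r //; apply: linear_setD.
Qed.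

Section Quadratic.
Variable Q : V -> F.
Definition quadratic_with_polar :=
  (forall a v, Q (a *: v) = a ^+ 2 * Q v) /\
  (forall u v, Q (u + v) = Q u + Q v + B u v).
Hypothesis Qform : quadratic_with_polar.

Lemma QZ a v : Q (a *: v) = a ^+ 2 * Q v. Proof. by case: Qform. Qed.
Lemma QD u v : Q (u + v) = Q u + Q v + B u v. Proof. by case: Qform. Qed.

Definition orthogonal_group : {group GL} := quadratic_isometries_group (n := n) Q.
Local Notation Orth := orthogonal_group.

Lemma OrthP (g : GL) : reflect (forall v, Q (ap v g) = Q v) (g \in Orth).
Proof. by rewrite inE; apply: (iffP forallP) => h v; apply/eqP; apply: h. Qed.

Lemma Orth_Sp : Orth \subset Sp.
Proof.
apply/subsetP=> g /OrthP gQ; apply/SpP=> u v.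
have BQ x y : B x y = Q (x + y) + Q x + Q y by rewrite QD; ring: two0.
by rewrite !BQ -apD !gQ.
Qed.

Lemma tv_Orth x : Q x = 1 -> tv x \in Orth.
Proof. by move=> x1; apply/OrthP=> v; rewrite tvE QD QZ BZr x1; ring: two0. Qed.

(** Nonsingular vectors are scaled to have value 1, as F is perfect. *)
Definition normalize x := (char2_sqrt ch2 (Q x))^-1 *: x.

Lemma Q_normalize x : Q x != 0 -> Q (normalize x) = 1.
Proof. by move=> x0; rewrite QZ exprVn char2_sqrtK mulVf. Qed.

Lemma ap_reflection x y : Q x != 0 -> ap y (tv (normalize x)) = y + (B y x / Q x) *: x.
Proof.
move=> x0; rewrite tvE /normalize BZr scalerA; congr (_ + _ *: _).
by rewrite -[Q x in RHS](char2_sqrtK ch2) mulrC mulrA -expr2 exprVn mulrC.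
Qed.

(** Let x satisfy the two linear conditions and let y be nonsingular. On the
   projective line through x and y, a quadratic form that is not zero has at most
   two zeros and each linear condition excludes at most one point, while there are q
   + 1 >= 5 points. *)
Lemma nonsingular_nonperp A w w' : linear_set A ->
    (exists2 x, A x & B w x != 0) -> (exists2 x, A x & B w' x != 0) ->
    (exists2 x, A x & Q x != 0) ->
  exists x, [/\ A x, Q x != 0, B w x != 0 & B w' x != 0].
Proof.
move=> Al wA w'A [y Ay Qy]; have [x [Ax wx w'x]] := nonperp2 Al wA w'A.
have [Qx|Qx] := eqVneq (Q x) 0; last by exists x.
have [/andP[wy w'y]|] := boolP ((B w y != 0) && (B w' y != 0)); first by exists y.
rewrite negb_and !negbK => wy.
(* If y is excluded by one linear condition, that condition excludes no point x + t
   y. *)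
pose s := if B w y == 0 then B w' x / B w' y else B w x / B w y.
have [t] : exists t, t \notin [:: 0; B x y / Q y; s] by apply: exists_notin.
rewrite !inE !negb_or => /and3P[t0 tQ ts].
exists (x + t *: y); split.
- by apply: linear_setD => //; apply: linear_setZ.
- rewrite QD QZ Qx BZr add0r; have -> : t ^+ 2 * Q y + t * B x y = t * (t * Q y + B x y) by ring.
  rewrite mulf_neq0 //; apply: contraNneq tQ => e.
  have -> : B x y = t * Q y by apply/eqP; rewrite -subr_eq0 oppF addrC e.
  by rewrite mulfK.
- rewrite BDr BZr; have [->|wy0] := eqVneq (B w y) 0; first by rewrite mulr0 addr0.
  apply: contraNneq ts; rewrite /s (negPf wy0) => /eqP.
  by rewrite -[_ * _]oppF subr_eq0 => /eqP->; rewrite mulfK.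
rewrite BDr BZr; have [->|w'y0] := eqVneq (B w' y) 0; first by rewrite mulr0 addr0.
rewrite (negPf w'y0) orbF in wy.
apply: contraNneq ts; rewrite /s wy => /eqP.
by rewrite -[_ * _]oppF subr_eq0 => /eqP->; rewrite mulfK.
Qed.

(** Quantifying over the subgroups K gives g in the group generated by the transvections
   of the vectors of A that satisfy ok, without turning A and ok into finite sets. *)
Definition generated_by (A ok : V -> Prop) (g : GL) :=
  forall K : {group GL}, (forall x, A x -> ok x -> tv x \in K) -> g \in K.

(** If u is nonsingular, the reflection in u moves w to w + u. Otherwise first apply
   the reflection in a vector x of A, chosen so that the difference with w + u becomes
   nonsingular. *)
Lemma reflection_transitive A w u : linear_set A ->
    (exists2 x, A x & B w x != 0) -> (exists2 x, A x & B (w + u) x != 0) ->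
    (exists2 x, A x & Q x != 0) -> A u -> Q (w + u) = Q w ->
  exists2 g, generated_by A (fun x => Q x = 1) g & ap w g = w + u.
Proof.
move=> Al wA w'A QA Au Qwu.
have Qu : Q u = B w u.
  by have := QD w u; rewrite Qwu => e; apply: (addrI (Q w)); rewrite {2}e; ring: two0.
have [u0|u0] := eqVneq (Q u) 0; last first.
  exists (tv (normalize u)); last by rewrite ap_reflection // -Qu divff // scale1r.
  by move=> K AK; apply: AK; [apply: linear_setZ | apply: Q_normalize].
have [x [Ax Qx wx w'x]] := nonsingular_nonperp Al wA w'A QA.
pose a := B w x / Q x; pose y := u + a *: x.
have wu0 : B w u = 0 by rewrite -Qu.
have a0 : a != 0 by rewrite mulf_neq0 ?invr_eq0.
have Qy : Q y = a * B (w + u) x.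
  by rewrite /y QD QZ u0 BZr BDl {1}/a expr2 /a; field: two0.
have Qy0 : Q y != 0 by rewrite Qy mulf_neq0.
have Ay : A y by apply: linear_setD => //; apply: linear_setZ.
exists (tv (normalize x) * tv (normalize y))%g.
  move=> K AK; apply: groupM; apply: AK;
    by [apply: linear_setZ | apply: Q_normalize].
rewrite apM ap_reflection // -/a ap_reflection //.
have -> : B (w + a *: x) y = Q y.
  by rewrite Qy /y !BE wu0 Balt (Bsym x u); ring.
by rewrite divff // scale1r /y addrACA addvv addr0.
Qed.

(** Conjugation turns the transitivity of reflections into membership of reflections. *)
Lemma tv_transport A (K : {group GL}) w u : linear_set A ->
    (exists2 x, A x & B w x != 0) -> (exists2 x, A x & B (w + u) x != 0) ->
    (exists2 x, A x & Q x != 0) -> A u -> Q (w + u) = Q w ->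
    K \subset Sp -> (forall x, A x -> Q x = 1 -> tv x \in K) ->
  (tv (w + u) \in K) = (tv w \in K).
Proof.
move=> Al wA w'A QA Au Qwu sKS AK.
have [g gA <-] := reflection_transitive Al wA w'A QA Au Qwu.
by rewrite tvJ_mem // gA.
Qed.

(** In a totally isotropic plane the transvections commute, and t_{r + b y} depends on
   the symmetric tensor of r + b y only; three values b with sum 0 give the product
   t_r. It serves when r is in the radical, hence moved by no reflection of
   the subspace under consideration. *)
Lemma tv_three r y (a : F) (K : {group GL}) : B r y = 0 -> a != 0 -> a != 1 ->
  (forall b : F, b != 0 -> tv (r + b *: y) \in K) -> tv r \in K.
Proof.
move=> ry a0 a1 hK.
pose x1 := r + 1 *: y; pose x2 := r + a *: y; pose x3 := r + (1 + a) *: y.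
have -> : tv r = (tv x1 * tv x2 * tv x3)%g.
  apply: ap_inj => v; rewrite !apM !tvE /x1 /x2 /x3 !BE !Balt (Bsym y r) ry.
  set p := B v r; set q := B v y.
  by apply/rowP=> j; rewrite !mxE; ring: two0 three1.
have a10 : 1 + a != 0 by apply: contraNneq a1 => e; rewrite eq_sym -subr_eq0 oppF e.
by do ?[apply: groupM]; apply: hK; rewrite ?oner_neq0.
Qed.

(** At most q + 1 vectors of the plane have value 1, as each line contains at most
   one. The orbit of e0 under the product of the two reflections has q + 1 elements:
   the linear form phi on the plane, with values in the extension, is an eigenvector
   of this product for z, so phi separates the q + 1 first images of e0. *)
Lemma pair_reflections c e0 e1 (K : {group GL}) : good_parameter c ->
    K \subset Sp -> tv e0 \in K -> tv e1 \in K ->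
    Q e0 = 1 -> Q e1 = 1 -> B e0 e1 = c ->
  forall a b, Q (a *: e0 + b *: e1) = 1 -> tv (a *: e0 + b *: e1) \in K.
Proof.
move=> [c0 cA [L [iota [z [zc zord]]]]] sKS K0 K1 Q0 Q1 B01.
pose vec (p : F * F) := p.1 *: e0 + p.2 *: e1.
pose S := [set p : F * F | p.1 ^+ 2 + c * p.1 * p.2 + p.2 ^+ 2 == 1].
have Qvec p : Q (vec p) = p.1 ^+ 2 + c * p.1 * p.2 + p.2 ^+ 2.
  by rewrite /vec QD !QZ Q0 Q1 !BE B01; ring.
have cardS : (#|S| <= #|F|.+1)%N.
  pose f (p : F * F) := if p.2 == 0 then None else Some (p.1 / p.2).
  have injf : {in S &, injective f}.
    move=> [a b] [a' b']; rewrite !inE /f /=.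
    case: (eqVneq b 0) => [->|b0]; case: (eqVneq b' 0) => [->|b'0] //.
      rewrite !mulr0 expr0n /= !addr0 => /eqP a1 /eqP a1' _.
      by congr (_, _); apply: (sqr_inj ch2); rewrite a1.
    move=> /eqP Sab /eqP Sab' [ab].
    have ea : a = (a / b) * b by rewrite divfK.
    have ea' : a' = (a / b) * b' by rewrite ab divfK.
    set r := a / b in ea ea'; rewrite {ab}ea ea' in Sab Sab' *.
    pose k := r ^+ 2 + c * r + 1.
    have Sk x : (r * x) ^+ 2 + c * (r * x) * x + x ^+ 2 = k * x ^+ 2 by rewrite /k; ring.
    have k0 : k != 0.
      by apply: contra_eq_neq Sab; rewrite Sk => ->; rewrite mul0r eq_sym oner_neq0.
    suff -> : b = b' by [].
    by apply: (sqr_inj ch2); apply: (mulfI k0); rewrite -!Sk Sab.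
  by rewrite -(card_in_imset injf) -card_option max_card.
pose G (p : F * F) := (p.1 + c * p.2, c * p.1 + (1 + c ^+ 2) * p.2).
have vecG p : ap (vec p) (tv e0 * tv e1)%g = vec (G p).
  rewrite /vec /G /= apM !tvE !BE !Balt (Bsym e1 e0) B01.
  by apply/rowP=> j; rewrite !mxE; ring: two0.
pose pt i := iter i G (1, 0).
have ptS i : pt i \in S.
  elim: i => [|i]; first by rewrite inE /= !mulr0 expr0n expr1n !addr0.
  rewrite !inE -!Qvec /pt iterS -/(pt i) -vecG => /eqP <-; apply/eqP.
  by apply/OrthP; apply: groupM; apply: tv_Orth.
have ptK i : tv (vec (pt i)) \in K.
  elim: i => [|i IHi]; first by rewrite /vec /= scale1r scale0r addr0.
  by rewrite /pt iterS -/(pt i) -vecG tvJ_mem //; apply: groupM.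
have g0 : iota c != 0 by rewrite fmorph_eq0.
have two0L : 2 = 0 :> L by rewrite -(rmorph_nat iota) two0 rmorph0.
pose phi (p : F * F) := iota p.1 + iota p.2 * ((z + 1) / iota c).
have phiG p : phi (G p) = z * phi p.
  rewrite /phi /G /= !(rmorphXn, rmorphD, rmorphM) rmorph1 /=.
  set g := iota c in g0 zc *; set x := iota _; set y := iota _.
  have e : (g + (1 + g ^+ 2) * ((z + 1) / g)) = z * ((z + 1) / g).
    apply: (mulIf g0).
    have -> : z * ((z + 1) / g) * g = z ^+ 2 + z + (z ^+ 2 + g ^+ 2 * z + 1) by rewrite zc; field.
    by field: two0L.
  transitivity (x * (1 + g * ((z + 1) / g)) + y * (g + (1 + g ^+ 2) * ((z + 1) / g))).
    by ring.
  by rewrite e mulrCA divff // mulr1; ring: two0L.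
have phipt i : phi (pt i) = z ^+ i.
  elim: i => [|i IHi]; first by rewrite /phi /= rmorph1 rmorph0 mul0r addr0.
  by rewrite /pt iterS -/(pt i) phiG IHi exprS.
have z0 : z != 0.
  by apply: contra_eq_neq zc => ->; rewrite expr0n mulr0 !add0r oner_neq0.
have pt_inj : injective (fun i : 'I_#|F|.+1 => pt i).
  suff lt_inj (i j : 'I_#|F|.+1) : pt i = pt j -> (i < j)%N -> False.
    move=> i j eij; apply/val_inj; case: (ltngtP i j) => // lt.
      by case: (lt_inj i j).
    by case: (lt_inj j i).
  move=> eij ltij; have := congr1 phi eij; rewrite !phipt -(subnK (ltnW ltij)).
  rewrite exprD -[X in X = _]mul1r => /(mulIf (expf_neq0 _ z0))/esym/zord/dvdn_leq.
  by have := ltn_ord j; lia.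
have SE : [set pt i | i : 'I_#|F|.+1] = S.
  apply/eqP; rewrite eqEcard card_imset // card_ord cardS andbT.
  by apply/subsetP=> _ /imsetP[i _ ->].
move=> a b; rewrite -/(vec (a, b)) Qvec => ab1.
have : (a, b) \in S by rewrite inE ab1.
by rewrite -SE => /imsetP[i _ ->].
Qed.

(** Let A be the plane of e0 and e1. The vectors with value 1, not orthogonal to A,
   with the same coordinate z on e2 are conjugate under the reflections of A; and
   t_{e2} replaces z by z + c1 y. With k z = (z+1)/c0 + c1 z/c0^2, a vector with
   coordinates y <> 0 and z exists if and only if k z / y is not in AS. So, if k z
   <> 0, the class of z is linked with more than q/2 classes (itself included), and
   it has one of them in common with the class 0, whose reflections are given. If k
   z = 0, the only vectors are in the radical, and tv_three applies. *)
Lemma triple_reflections (c0 c1 : F) e0 e1 e2 (K : {group GL}) :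
    c0 != 0 -> c0^-1 \notin AS F -> c1 != 0 -> K \subset Sp ->
    (forall a b, Q (a *: e0 + b *: e1) = 1 -> tv (a *: e0 + b *: e1) \in K) ->
    tv e2 \in K -> Q e0 = 1 -> Q e1 = 1 -> Q e2 = 1 ->
    B e0 e1 = c0 -> B e1 e2 = c1 -> B e0 e2 = 0 ->
  forall x y z, Q (x *: e0 + y *: e1 + z *: e2) = 1 ->
    tv (x *: e0 + y *: e1 + z *: e2) \in K.
Proof.
move=> c00 c0A c10 sKS K01 K2 Q0 Q1 Q2 B01 B12 B02.
pose vec x y z := x *: e0 + y *: e1 + z *: e2.
have B0 x y z : B (vec x y z) e0 = c0 * y.
  by rewrite /vec !BE Balt (Bsym e1) (Bsym e2 e0) B01 B02; ring.
have B1 x y z : B (vec x y z) e1 = c0 * x + c1 * z.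
  by rewrite /vec !BE Balt B01 (Bsym e2) B12; ring.
have B2 x y z : B (vec x y z) e2 = c1 * y.
  by rewrite /vec !BE Balt B12 B02; ring.
have Qvec x y z : Q (vec x y z) = x ^+ 2 + y ^+ 2 + z ^+ 2 + c0 * x * y + c1 * y * z.
  by rewrite /vec !QD !QZ Q0 Q1 Q2 !BE B01 B12 B02; ring.
pose A v := exists a b, v = a *: e0 + b *: e1.
have Alin : linear_set A.
  split=> [|t u v [a [b ->]] [a' [b' ->]]]; first by exists 0, 0; rewrite !scale0r addr0.
  exists (t * a + a'), (t * b + b').
  by apply/rowP=> j; rewrite !mxE; ring.
have Ae0 : A e0 by exists 1, 0; rewrite scale1r scale0r addr0.
have Ae1 : A e1 by exists 0, 1; rewrite scale1r scale0r add0r.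
pose k z := (z + 1) / c0 + c1 * z / c0 ^+ 2.
(* Vectors orthogonal to A occur only in the class k z = 0. *)
have nonperp x y z : Q (vec x y z) = 1 -> k z != 0 ->
    exists2 v, A v & B (vec x y z) v != 0.
  move=> Qv kz; have [y0|y0] := eqVneq y 0; last first.
    by exists e0; rewrite ?B0 ?mulf_neq0.
  exists e1; rewrite // B1; apply: contra kz => /eqP e.
  have cx : c0 * x = c1 * z by rewrite -[RHS]add0r -e; ring: two0.
  have xz : x + z = 1.
    apply: (sqr_inj ch2); rewrite expr1n -Qv Qvec y0; ring: two0.
  have -> : z = 1 + x by rewrite -xz; ring: two0.
  have -> : k (1 + x) = (x + c1 * (1 + x) / c0) / c0 by rewrite /k; field: two0.
  rewrite -xz in cx *; rewrite (_ : x + z + x = z) in cx *; last by ring: two0.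
  rewrite -cx mulrAC divff // mul1r.
  by rewrite (_ : x + x = 0) ?mul0r //; ring: two0.
have class_mem x y x' y' z : Q (vec x y z) = 1 -> Q (vec x' y' z) = 1 ->
    (exists2 v, A v & B (vec x y z) v != 0) ->
    (exists2 v, A v & B (vec x' y' z) v != 0) ->
    tv (vec x y z) \in K -> tv (vec x' y' z) \in K.
  move=> Qv Qv' nv nv' Kv.
  have e : vec x' y' z = vec x y z + ((x + x') *: e0 + (y + y') *: e1).
    by rewrite /vec; apply/rowP=> j; rewrite !mxE; ring: two0.
  rewrite e (@tv_transport A) //.
  - by rewrite -e.
  - by exists e0; rewrite // Q0 oner_neq0.
  - by exists (x + x'), (y + y').
  - by rewrite -e Qv'.
  by move=> _ [a [b ->]]; apply: K01.
have npy x y z : y != 0 -> exists2 v, A v & B (vec x y z) v != 0.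
  by move=> y0; exists e0; rewrite ?B0 ?mulf_neq0.
have K0z x y : Q (vec x y 0) = 1 -> tv (vec x y 0) \in K.
  by rewrite /vec scale0r addr0; apply: K01.
have ap2 x y z : ap (vec x y z) (tv e2) = vec x y (z + c1 * y).
  by rewrite tvE B2 /vec scalerDl addrA.
have step_mem x y z : (tv (vec x y (z + c1 * y)) \in K) = (tv (vec x y z) \in K).
  by rewrite -ap2 tvJ_mem.
have step_Q x y z : Q (vec x y (z + c1 * y)) = Q (vec x y z).
  by rewrite -ap2; apply/OrthP/tv_Orth.
have k0 : k 0 != 0 by rewrite /k add0r mulr0 mul0r addr0 mul1r invr_eq0.
have nAS0 t : t \notin AS F -> t != 0.
  by apply: contraNneq => ->; apply: AS0.
have step_ex z t : k z != 0 -> t \notin AS F ->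
    exists x, Q (vec x (k z / t) z) = 1.
  move=> kz tA; set y := k z / t; have t0 := nAS0 t tA.
  have y0 : y != 0 by rewrite mulf_neq0 ?invr_eq0.
  have [|x ex] := @quadratic_root _ ch2 (c0 * y) (y ^+ 2 + z ^+ 2 + c1 * y * z + 1) (mulf_neq0 c00 y0).
    pose a := (z + 1) / (c0 * y).
    have -> : (y ^+ 2 + z ^+ 2 + c1 * y * z + 1) / (c0 * y) ^+ 2
        = (a ^+ 2 + a) + (c0^-1 ^+ 2 + k z / y).
      by rewrite /a /k; field: two0; rewrite y0 c00.
    rewrite AS_addr //; last by apply/ASP; exists a.
    apply: AS_notin_add => //; first by rewrite AS_sqr.
    by rewrite /y invf_div mulrC divfK.
  exists x; rewrite Qvec; apply/eqP; rewrite -subr_eq0 oppF -ex; apply/eqP; ring.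
pose D z := z |: [set z + c1 * (k z / t) | t in ~: AS F].
have cardD z : k z != 0 -> (#|F| < #|D z| * 2)%N.
  move=> kz; rewrite /D cardsU1 card_in_imset; last first.
    move=> t t' _ _ /addrI/(mulfI c10)/(mulfI kz)/invr_inj //.
  have -> : z \notin [set z + c1 * (k z / t) | t in ~: AS F].
    apply/imsetP=> -[t]; rewrite inE => /nAS0 t0 /eqP.
    by rewrite -[X in X == _]addr0 (inj_eq (addrI z)) eq_sym !mulf_eq0 (negPf c10) (negPf kz) invr_eq0 (negPf t0).
  have cC : (#|AS F| + #|~: AS F|)%N = #|F| := cardsC _.
  have := card_AS ch2; rewrite -cC; move: #|AS F| #|~: AS F| => u v e.
  by rewrite -[nat_of_bool true]/1%N; nlia.
have good z x y : k z != 0 -> Q (vec x y z) = 1 -> tv (vec x y z) \in K.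
  move=> kz Qv; have [s /setIP[s0 sz]] : exists s, s \in D 0 :&: D z.
    apply/set0Pn; rewrite -card_gt0.
    set D0 := D 0; have m : (#|D0 :|: D z| <= #|F|)%N := max_card _.
    move: (cardD 0 k0) (cardD z kz) (cardsUI D0 (D z)) m; rewrite -/D0.
    move: #|D0| #|D z| #|F| #|D0 :|: D z| #|D0 :&: D z| => *; nlia.
  have mem0 w : w \in D 0 -> w = 0 \/ exists x0 y0,
      [/\ Q (vec x0 y0 w) = 1, y0 != 0 & tv (vec x0 y0 w) \in K].
    rewrite !inE => /orP[/eqP->|/imsetP[t]]; first by left.
    rewrite inE => tA ->; right; have [x0 Q00] := step_ex 0 t k0 tA.
    exists x0, (k 0 / t); rewrite step_mem step_Q.
    by split=> //; [rewrite mulf_neq0 ?invr_eq0 ?(nAS0 t tA) | apply: K0z].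
  move: sz; rewrite !inE => /orP[/eqP sE|/imsetP[t]].
    rewrite {}sE in s0; case/mem0: s0 => [z0|[x0 [y0 [Q00 y00 K00]]]].
      by rewrite z0 in Qv *; apply: K0z.
    by apply: (class_mem x0 y0) => //; [apply: npy | apply: nonperp].
  rewrite inE => tA sE; have [x1 Q11] := step_ex z t kz tA.
  set y1 := k z / t in Q11 sE; have y10 : y1 != 0 by rewrite mulf_neq0 ?invr_eq0 ?(nAS0 t tA).
  apply: (class_mem x1 y1) => //; [exact: npy | exact: nonperp |].
  have Q1s : Q (vec x1 y1 s) = 1 by rewrite sE step_Q.
  rewrite -step_mem -sE; case/mem0: s0 => [z0|[x0 [y0 [Q00 y00 K00]]]].
    by rewrite z0 in Q1s *; apply: K0z.
  by apply: (class_mem x0 y0) => //; apply: npy.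
move=> x y z Qv; rewrite -/(vec x y z).
have [kz|kz] := eqVneq (k z) 0; last exact: good.
have y0 : y = 0.
  apply: contraNeq c0A => y0; pose a := (z + 1) / (c0 * y).
  have e : (x / (c0 * y)) ^+ 2 + x / (c0 * y) = (a ^+ 2 + a) + c0^-1 ^+ 2.
    have -> : c0^-1 ^+ 2 = c0^-1 ^+ 2 + k z / y + (Q (vec x y z) + 1) / (c0 * y) ^+ 2.
      by rewrite kz Qv mul0r addr0 (_ : 1 + 1 = 0) ?mul0r ?addr0 //; ring: two0.
    rewrite Qvec /a /k; field: two0; rewrite y0 c00 //.
  rewrite -(AS_sqr ch2) -(@AS_addr _ ch2 (a ^+ 2 + a)); last by apply/ASP; exists a.
  by rewrite -e; apply/ASP; exists (x / (c0 * y)).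
(* For c0 = c1 the function k is the constant 1/c0. *)
have c01 : c0 + c1 != 0.
  apply: contra_eq_neq kz => c01; have c1E : c1 = c0 by rewrite -[RHS]addr0 -c01; ring: two0.
  have -> : k z = c0^-1 by rewrite /k c1E; field: two0.
  by rewrite invr_eq0.
have [a] : exists a : F, a \notin [:: 0; 1] by apply: exists_notin; apply: leq_trans F4.
rewrite !inE negb_or => /andP[a0 a1].
(* Here x e0 + z e2 is in the radical; e0 + e2 is singular and is not in it. *)
apply: (@tv_three _ (e0 + e2) a) => // [|b b0].
  by rewrite BDr B0 B2 y0; ring.
have -> : vec x y z + b *: (e0 + e2) = vec (x + b) y (z + b).
  by apply/rowP=> j; rewrite !mxE; ring.
apply: good.
  have -> : k (z + b) = k z + b * (c0 + c1) / c0 ^+ 2 by rewrite /k; field.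
  by rewrite kz add0r !mulf_neq0 ?invr_eq0 ?expf_neq0.
by rewrite -Qv !Qvec y0; ring: two0.
Qed.

End Quadratic.

(** The analogue of reflection_transitive, where any vector may be used. *)
Lemma transvection_transitive A w u : linear_set A ->
    (exists2 x, A x & B w x != 0) -> (exists2 x, A x & B (w + u) x != 0) -> A u ->
  exists2 g, generated_by A (fun _ => True) g & ap w g = w + u.
Proof.
move=> Al wA w'A Au.
have one z y : A y -> B z y != 0 -> exists2 g, generated_by A (fun _ => True) g & ap z g = z + y.
  move=> Ay zy; exists (tv ((char2_sqrt ch2 (B z y))^-1 *: y)).
    by move=> K hK; apply: hK => //; apply: linear_setZ.
  by rewrite tvE BZr scalerA mulrAC -expr2 exprVn char2_sqrtK mulVf // scale1r.
have [wu|wu] := eqVneq (B w u) 0; last exact: one.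
have [x [Ax wx w'x]] := nonperp2 Al wA w'A.
have [g gA wg] := one w x Ax wx.
have [|h hA zh] := one (w + x) (u + x) (linear_setD Al Au Ax).
  by move: w'x; rewrite !BE Balt wu (Bsym x u) addr0 add0r.
exists (g * h)%g; first by move=> K hK; apply: groupM; [apply: gA | apply: hA].
by rewrite apM wg zh addrACA addvv addr0.
Qed.

(** * Stabilizers of dual basis vectors *)
Section DualBases.
Variables (N : nat) (v w : nat -> V).

Definition dual_bases :=
  (forall i j, (i < N)%N -> (j < N)%N -> B (v i) (w j) = (i == j)%:R) /\
  (forall x, (forall j, (j < N)%N -> B x (w j) = 0) -> x = 0).

Hypothesis dual : dual_bases.

(** Membership in the span of the v i with a <= i < b, read on the dual basis. *)
Definition supported a b x := forall j, (j < N)%N -> ~~ itv a b j -> B x (w j) = 0.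

Lemma dualE i j : (i < N)%N -> (j < N)%N -> B (v i) (w j) = (i == j)%:R.
Proof. by case: dual => h _; apply: h. Qed.

Lemma supported_linear a b : linear_set (supported a b).
Proof.
split=> [j|t x y Ax Ay j ltj nj]; first by rewrite B0l.
by rewrite BDl BZl Ax ?Ay // mulr0 addr0.
Qed.

Lemma supported_v a b i : (i < N)%N -> itv a b i -> supported a b (v i).
Proof.
by move=> lti abi j ltj; rewrite dualE //; case: eqP => // <-; rewrite abi.
Qed.

Lemma supportedS a b a' b' x : (forall i, itv a b i -> itv a' b' i) ->
  supported a b x -> supported a' b' x.
Proof. by move=> s Sx j ltj nj; apply: Sx => //; apply: contra nj; apply: s. Qed.

Lemma supported0 a b x : (b <= a)%N -> supported a b x -> x = 0.
Proof.
move=> leba Sx; case: dual => _; apply=> j ltj; apply: Sx => //; rewrite /itv; lia.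
Qed.

Lemma supported_last a b x : (b < N)%N -> supported a b.+1 x ->
  exists t y, supported a b y /\ x = t *: v b + y.
Proof.
move=> ltb Sx; exists (B x (w b)), (B x (w b) *: v b + x); split; last by rewrite addvK.
move=> j ltj nj; rewrite BDl BZl dualE //.
have [<-|bj] := eqVneq b j; first by rewrite mulr1; ring: two0.
rewrite mulr0 add0r Sx //; move: nj bj; rewrite /itv; lia.
Qed.

Lemma supported_first a b x : (a < N)%N -> supported a b x ->
  exists t y, supported a.+1 b y /\ x = t *: v a + y.
Proof.
move=> lta Sx; exists (B x (w a)), (B x (w a) *: v a + x); split; last by rewrite addvK.
move=> j ltj nj; rewrite BDl BZl dualE //.
have [<-|aj] := eqVneq a j; first by rewrite mulr1; ring: two0.
rewrite mulr0 add0r Sx //; move: nj aj; rewrite /itv; lia.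
Qed.

Lemma tv_fixes_dual a b x j : (j < N)%N -> ~~ itv a b j -> supported a b x ->
  tv x \in fixer (w j).
Proof. by move=> ltj nj Sx; apply/fixerP; rewrite tvE Bsym Sx // scale0r addr0. Qed.

Lemma fixes_dual_id g : g \in Sp ->
  (forall j, (j < N)%N -> ap (w j) g = w j) -> g = 1%g.
Proof.
move=> /SpP gS fixg; apply: ap_inj => x; rewrite ap1.
apply/eqP; rewrite -subr_eq0 oppv; apply/eqP.
by case: dual => _; apply=> j ltj; rewrite BDl -{1}(fixg j) // gS; ring: two0.
Qed.

(** Cartan-Dieudonne, by induction on the length of the interval: h, generated by
   transvections, moves the last dual vector w b as g does, so g h^-1 fixes one more
   dual vector. The group Gam is O(Q) or Sp, and ok singles out its transvections.
   *)
Lemma generated_of_fixes (Gam : {group GL}) (ok : V -> Prop) a b g :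
    Gam \subset Sp -> (forall x, ok x -> tv x \in Gam) ->
    (forall i, (i < N)%N -> ok (v i)) ->
    (forall A z u, linear_set A -> (exists2 x, A x & B z x != 0) ->
        (exists2 x, A x & B (z + u) x != 0) -> (exists2 x, A x & ok x) -> A u ->
        (exists2 h, h \in Gam & ap z h = z + u) ->
      exists2 h, generated_by A ok h & ap z h = z + u) ->
    (b <= N)%N -> g \in Gam ->
    (forall j, (j < N)%N -> ~~ itv a b j -> ap (w j) g = w j) ->
  generated_by (supported a b) ok g.
Proof.
move=> sGS okG okv trans; elim: b g => [|b IHb] g lebN gG fixg.
  suff -> : g = 1%g by move=> K _; apply: group1.
  by apply: fixes_dual_id => [|j ltj]; [apply: (subsetP sGS) | apply: fixg; rewrite // /itv andbF].
have gS := SpP _ (subsetP sGS _ gG).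
have [ltba|leab] := ltnP b a.
  suff -> : g = 1%g by move=> K _; apply: group1.
  apply: fixes_dual_id => [|j ltj]; first exact: (subsetP sGS).
  by apply: fixg; rewrite // /itv; lia.
pose u := w b + ap (w b) g.
have wg : w b + u = ap (w b) g by rewrite addvK.
have Su : supported a b.+1 u.
  move=> j ltj nj; rewrite BDl -{2}(fixg j) // gS; ring: two0.
have Svg : supported a b.+1 (ap (v b) g).
  move=> j ltj nj; rewrite -(fixg j) // gS dualE //.
  by case: eqP nj => // <-; rewrite /itv; lia.
have Svb : supported a b.+1 (v b) by apply: supported_v; rewrite // /itv; lia.
have [||||||h hA wh] := trans (supported a b.+1) (w b) u.
- exact: supported_linear.
- by exists (v b); rewrite // Bsym dualE // eqxx oner_neq0.
- by exists (ap (v b) g); rewrite // wg gS Bsym dualE // eqxx oner_neq0.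
- by exists (v b) => //; apply: okv.
- exact: Su.
- by exists g.
have hG : h \in Gam by apply: hA => x _; apply: okG.
have ghG : (g * h^-1)%g \in Gam by apply: groupM => //; apply: groupVr.
have {}IHb : generated_by (supported a b) ok (g * h^-1)%g.
  apply: IHb => // [|j ltj nj]; first exact: ltnW.
  rewrite apM; have [->|jb] := eqVneq j b; first by rewrite -wg -wh apK.
  have nj' : ~~ itv a b.+1 j by move: nj jb; rewrite /itv; clear; lia.
  rewrite fixg //; apply/fixerP; apply: groupVr; apply: hA => x Sx _.
  exact: tv_fixes_dual Sx.
move=> K hK; rewrite -(mulgKV h g); apply: groupM; last exact: hA.
apply: IHb => x Sx; apply: hK; apply: supportedS Sx => i; rewrite /itv; clear; lia.
Qed.

End DualBases.

(** * Reflections along a path *)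
Lemma order_tv x : x != 0 -> #[tv x]%g = 2%N.
Proof.
move=> x0; apply: nt_prime_order => //; first by rewrite expgS expg1 tv_invol.
apply: contra x0 => /eqP t1; apply/eqP/tv_inj; rewrite t1; apply: ap_inj => y.
by rewrite tvE ap1 scaler0 addr0.
Qed.

Definition path_system M (u : nat -> V) :=
  (forall i j, (i < M)%N -> (j < M)%N -> (i.+1 < j)%N -> B (u i) (u j) = 0) /\
  (forall i, (i.+1 < M)%N -> B (u i) (u i.+1) != 0).

Lemma tv_linked_string M u : path_system M u -> (forall i, (i < M)%N -> u i != 0) ->
  interval_property M (tv \o u) -> linked_string M (tv \o u).
Proof.
move=> [far link] u0 ipr; split=> //=.
- by move=> i lti; apply: order_tv; apply: u0.
- by move=> i j lti ltj ltij; apply: tv_commute; apply: far.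
- by move=> i lti; apply: tv_noncommute; apply: link.
- by move=> i _ lti; apply: odd_order_tvM; apply: link.
Qed.

Section Path.
Variable Q : V -> F.
Hypothesis Qform : quadratic_with_polar Q.
Variables (N : nat) (v w : nat -> V) (c : F).
Hypothesis N4 : (3 < N)%N.
Hypothesis dual : dual_bases N v w.
Hypothesis cgood : good_parameter c.

Local Notation Orth := (orthogonal_group Q).

Hypothesis vpath : path_system N v.
Hypothesis Qv : forall i, (i < N)%N -> Q (v i) = 1.
Hypothesis vgood : forall i, (0 < i)%N -> (i.+2 < N)%N -> B (v i) (v i.+1) = c.

Let rho i := tv (v i).
Let H a b : {group GL} := gen_by N rho (itv a b).

Definition full a b := forall x, supported N w a b x -> Q x = 1 -> tv x \in H a b.

Let far i j : (i < N)%N -> (j < N)%N -> (i.+1 < j)%N -> B (v i) (v j) = 0.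
Proof. by case: vpath => h _; apply: h. Qed.
Let link i : (i.+1 < N)%N -> B (v i) (v i.+1) != 0.
Proof. by case: vpath => _ h; apply: h. Qed.

Lemma H_Orth a b : H a b \subset Orth.
Proof. by apply/gen_by_subP=> i lti _; apply: tv_Orth => //; apply: Qv. Qed.

Lemma H_Sp a b : H a b \subset Sp.
Proof. exact: subset_trans (H_Orth a b) (Orth_Sp Qform). Qed.

Lemma rho_H a b i : (i < N)%N -> itv a b i -> tv (v i) \in H a b.
Proof. exact: mem_gen_by. Qed.

Lemma H_S a b a' b' g : (forall i, itv a b i -> itv a' b' i) -> g \in H a b -> g \in H a' b'.
Proof. by move=> s gH; apply: mem_gen_byS gH _ => i _; apply: s. Qed.

Lemma full_empty a b : (b <= a)%N -> full a b.
Proof.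
move=> leba x /(supported0 dual leba)-> /eqP.
by rewrite -[0](scale0r (0 : V)) (QZ Qform) expr0n mul0r eq_sym oner_eq0.
Qed.

Lemma full1 a : (a < N)%N -> full a a.+1.
Proof.
move=> lta x /(supported_last dual lta)[t [y [Sy ->]]].
rewrite (supported0 dual (leqnn a) Sy) addr0 (QZ Qform) Qv // mulr1 => t1.
have -> : t = 1 by apply: (sqr_inj ch2); rewrite t1 expr1n.
by rewrite scale1r; apply: rho_H; rewrite // /itv; lia.
Qed.

Lemma full2 a : (0 < a)%N -> (a.+2 < N)%N -> full a a.+2.
Proof.
move=> a0 lta x.
have [ltaN lta1] : (a < N)%N /\ (a.+1 < N)%N by lia.
move=> /(supported_first dual ltaN)[t [y [Sy ->]]].
have [s [z [/(supported0 dual (leqnn _))-> ->]]] := supported_last dual lta1 Sy.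
rewrite addr0; apply: (pair_reflections Qform cgood); rewrite ?Qv ?vgood ?H_Sp //;
  by apply: rho_H; rewrite // /itv; lia.
Qed.

(** The good link of a triple is the first one, except for the triple at the start
   of the path. *)
Lemma full3 a : (a.+2 < N)%N -> full a a.+3.
Proof.
move=> lta x.
have [ltaN lta1] : (a < N)%N /\ (a.+1 < N)%N by lia.
move=> /(supported_first dual ltaN)[t0 [y0 [/(supported_first dual lta1)[t1 [y [Sy ->]]] ->]]].
have [t2 [z [/(supported0 dual (leqnn _))-> ->]]] := supported_last dual lta Sy.
have [c0 cA _] := cgood; rewrite addr0.
have memH i : (a <= i < a.+3)%N -> tv (v i) \in H a a.+3.
  by move=> Ii; apply: rho_H; rewrite // /itv; lia.
case: (posnP a) => [a0|a0].
  have -> : t0 *: v a + (t1 *: v a.+1 + t2 *: v a.+2) =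
            t2 *: v a.+2 + t1 *: v a.+1 + t0 *: v a.
    by rewrite addrA addrC [t0 *: _ + _]addrC addrA.
  have c1 : B (v a.+1) (v a.+2) = c by apply: vgood; lia.
  apply: (triple_reflections Qform (c0 := c) (c1 := B (v a) (v a.+1)));
    rewrite ?Qv ?H_Sp ?link ?memH // 1?Bsym // ?far //; try lia.
  move=> b1 b2 Qb; apply: (@H_S a.+1 a.+3); first by move=> i; rewrite /itv; lia.
  have lt3 : (a.+3 < N)%N by lia.
  apply: (@full2 a.+1) => //; have L := supported_linear N w a.+1 a.+3.
  apply: (linear_setD L); apply: (linear_setZ _ L);
    by apply: supported_v; rewrite // /itv; lia.
rewrite addrA.
have c1 : B (v a) (v a.+1) = c by apply: vgood; lia.
apply: (triple_reflections Qform (c0 := c) (c1 := B (v a.+1) (v a.+2)));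
  rewrite ?Qv ?H_Sp ?link ?memH // ?far //; try lia.
move=> b1 b2 Qb; apply: (@H_S a a.+2); first by move=> i; rewrite /itv; lia.
apply: (@full2 a) => //; have L := supported_linear N w a a.+2.
apply: (linear_setD L); apply: (linear_setZ _ L);
  by apply: supported_v; rewrite // /itv; lia.
Qed.

Lemma Q_far_pair t s i j : (i < N)%N -> (j < N)%N -> (i.+1 < j)%N ->
  Q (t *: v i + s *: v j) = t ^+ 2 + s ^+ 2.
Proof.
move=> lti ltj ltij; rewrite (QD Qform) !(QZ Qform) !Qv // !BE far // !mulr0 addr0.
by rewrite !mulr1.
Qed.

(** Let u have value 1 and coefficient t on v a. If u is not orthogonal to the span
   of the vectors after v a, it is conjugate under their reflections to t v_a + (1 +
   t) v_{a+2}, which also has value 1 and does not involve the last vector of the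
   interval. The mirror image treats the other end. If u is orthogonal to both
   spans, it is in the radical, and u + s y with y = v_a + v_{a+2} is not, for s <>
   0. *)
Lemma full_step a e : (a <= e)%N -> (e.+3 < N)%N ->
  full a.+1 e.+4 -> full a e.+3 -> full a e.+4.
Proof.
move=> leae lteN full_r full_l.
have SL k l := supported_linear N w k l.
have Sv k l i : (i < N)%N -> itv k l i -> supported N w k l (v i).
  exact: supported_v.
have Kr x : supported N w a.+1 e.+4 x -> Q x = 1 -> tv x \in H a e.+4.
  move=> Sx Qx; apply: H_S (full_r x Sx Qx) => i; rewrite /itv; lia.
have Kl x : supported N w a e.+3 x -> Q x = 1 -> tv x \in H a e.+4.
  move=> Sx Qx; apply: H_S (full_l x Sx Qx) => i; rewrite /itv; lia.
have sq1 (t : F) : t ^+ 2 + (1 + t) ^+ 2 = 1 by ring: two0.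
have up u : supported N w a e.+4 u -> Q u = 1 ->
    (exists2 x, supported N w a.+1 e.+4 x & B u x != 0) -> tv u \in H a e.+4.
  have ltaN : (a < N)%N by lia.
  have lta2N : (a.+2 < N)%N by lia.
  have lta3N : (a.+3 < N)%N by lia.
  move=> /(supported_first dual ltaN)[t [y [Sy def_u]]] Qu npu.
  pose u' := t *: v a + (1 + t) *: v a.+2; pose s := (1 + t) *: v a.+2 + y.
  have us : u = u' + s by rewrite /u' /s -addrA addvK.
  have Qu' : Q u' = 1 by rewrite Q_far_pair.
  have Ss : supported N w a.+1 e.+4 s.
    apply: (linear_setD (SL _ _)) => //; apply: (linear_setZ _ (SL _ _)).
    by apply: Sv; rewrite // /itv; lia.
  rewrite us (tv_transport Qform (SL a.+1 e.+4)) //; rewrite -?us ?Qu ?Qu' ?H_Sp //.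
  - apply: Kl => //; apply: (linear_setD (SL _ _)); apply: (linear_setZ _ (SL _ _));
      by apply: Sv; rewrite // /itv; lia.
  - have [t1|t1] := eqVneq (1 + t) 0.
      exists (v a.+1); first by apply: Sv; rewrite // /itv; lia.
      have te : t = 1 by rewrite -[LHS]addr0 -t1; ring: two0.
      by rewrite /u' te (_ : 1 + 1 = 0) ?scale0r ?addr0 ?scale1r ?link //; first [ring: two0 | lia].
    exists (v a.+3); first by apply: Sv; rewrite // /itv; lia.
    by rewrite /u' BDl !BZl (far ltaN lta3N) ?mulr0 ?add0r ?mulf_neq0 ?link //; lia.
  exists (v a.+1); first by apply: Sv; rewrite // /itv; lia.
  by rewrite Qv ?oner_neq0 //; lia.
have dn u : supported N w a e.+4 u -> Q u = 1 ->
    (exists2 x, supported N w a e.+3 x & B u x != 0) -> tv u \in H a e.+4.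
  have lte1N : (e.+1 < N)%N by lia.
  move=> /(supported_last dual lteN)[t [y [Sy def_u]]] Qu npu.
  pose u' := (1 + t) *: v e.+1 + t *: v e.+3; pose s := (1 + t) *: v e.+1 + y.
  have us : u = u' + s by rewrite def_u /u' /s addrACA addvv add0r.
  have Qu' : Q u' = 1 by rewrite Q_far_pair // addrC.
  have Ss : supported N w a e.+3 s.
    apply: (linear_setD (SL _ _)) => //; apply: (linear_setZ _ (SL _ _)).
    by apply: Sv; rewrite // /itv; lia.
  rewrite us (tv_transport Qform (SL a e.+3)) //; rewrite -?us ?Qu ?Qu' ?H_Sp //.
  - apply: Kr => //; apply: (linear_setD (SL _ _)); apply: (linear_setZ _ (SL _ _));
      by apply: Sv; rewrite // /itv; lia.
  - have [t1|t1] := eqVneq (1 + t) 0.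
      exists (v e.+2); first by apply: Sv; rewrite // /itv; lia.
      have te : t = 1 by rewrite -[LHS]addr0 -t1; ring: two0.
      by rewrite /u' te (_ : 1 + 1 = 0) ?scale0r ?add0r ?scale1r 1?Bsym ?link //; first [ring: two0 | lia].
    exists (v e); first by apply: Sv; rewrite // /itv; lia.
    have e0N : (e < N)%N by lia.
    by rewrite /u' BDl !BZl Bsym (Bsym (v e.+3)) (far e0N lteN) // ?mulr0 ?addr0 ?mulf_neq0 ?link //; lia.
  exists (v e.+1); first by apply: Sv; rewrite // /itv; lia.
  by rewrite Qv ?oner_neq0.
move=> u Su Qu.
have [/existsP[j /andP[abj uj]]|npr] := boolP [exists j : 'I_N, itv a.+1 e.+4 j && (B u (v j) != 0)].
  by apply: up => //; exists (v j) => //; apply: Sv.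
have [/existsP[j /andP[abj uj]]|npl] := boolP [exists j : 'I_N, itv a e.+3 j && (B u (v j) != 0)].
  by apply: dn => //; exists (v j) => //; apply: Sv.
have perp j : (j < N)%N -> itv a e.+4 j -> B u (v j) = 0.
  move=> ltj abj; apply/eqP; apply: contraT => uj.
  have [a_j|a_j] := ltnP a j.
    case/existsP: npr; exists (Ordinal ltj); rewrite uj andbT /=.
    by move: abj; rewrite /itv; clear -a_j; lia.
  case/existsP: npl; exists (Ordinal ltj); rewrite uj andbT /=.
  by move: abj; rewrite /itv; clear -a_j leae; lia.
have [lta lta2 lta3] : [/\ (a < N)%N, (a.+2 < N)%N & (a.+3 < N)%N] by split; lia.
have [t] : exists t : F, t \notin [:: 0; 1] by apply: exists_notin; apply: leq_trans F4.
rewrite !inE negb_or => /andP[t0 t1].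
pose y := 1 *: v a + 1 *: v a.+2.
have uy : B u y = 0.
  by rewrite /y !BE !perp ?mulr0 ?addr0 // /itv; lia.
apply: (tv_three uy t0 t1) => s s0; apply: up.
- apply: (linear_setD (SL _ _)) => //; apply: (linear_setZ _ (SL _ _)).
  apply: (linear_setD (SL _ _)); apply: (linear_setZ _ (SL _ _));
    by apply: Sv; rewrite // /itv; lia.
- by rewrite (QD Qform) (QZ Qform) Q_far_pair // BZr uy Qu; ring: two0.
exists (v a.+3); first by apply: Sv; rewrite // /itv; lia.
rewrite BDl perp ?add0r ?BZl //; last by rewrite /itv; lia.
by rewrite mulf_neq0 // /y !BE (far lta) // mulr0 add0r mul1r link.
Qed.

Lemma full_large a b : (a.+3 <= b)%N -> (b <= N)%N -> full a b.
Proof.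
have [k] := ubnP (b - a)%N; elim: k a b => // k IHk a b ltk ltab lebN.
have [->|b3] := eqVneq b a.+3; first by apply: full3; lia.
have eb : b = (b - 4).+4 by lia.
rewrite eb; apply: full_step; try lia; apply: IHk; lia.
Qed.

Lemma full_inner a b : (0 < a)%N -> (b < N)%N -> full a b.
Proof.
move=> a0 ltb; have [leba|ltab] := leqP b a; first exact: full_empty.
have [->|b1] := eqVneq b a.+1; first by apply: full1; lia.
have [b2|b2] := eqVneq b a.+2; first by rewrite b2 in ltb *; apply: full2.
by apply: full_large; lia.
Qed.

Lemma mem_full_gen a b g : (b <= N)%N -> full a b -> g \in Orth ->
  (forall j, (j < N)%N -> ~~ itv a b j -> ap (w j) g = w j) -> g \in H a b.
Proof.
move=> lebN fab gO fixg.
suff gen_g : generated_by (supported N w a b) (fun x => Q x = 1) g by apply: gen_g.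
apply: (generated_of_fixes dual (Gam := orthogonal_group Q)) => //.
- exact: Orth_Sp.
- exact: tv_Orth.
move=> A z u Al zA zuA [x Ax Qx] Au [h hO zh].
apply: (reflection_transitive Qform) => //; first by exists x; rewrite // Qx oner_neq0.
by rewrite -zh; apply/OrthP.
Qed.

Lemma H_fixes a b g j : (j < N)%N -> ~~ itv a b j -> g \in H a b -> ap (w j) g = w j.
Proof.
move=> ltj nj gH; apply/fixerP; apply: subsetP gH; apply/gen_by_subP=> i lti abi.
by apply: tv_fixes_dual nj (supported_v dual lti abi).
Qed.

(** An element of both groups fixes the dual vectors outside a < i < b - 1, and this
   inner interval is full, as it contains neither the first nor the last index. *)
Lemma path_interval_property : interval_property N rho.
Proof.
move=> a b leabN; apply/subsetP=> g /setIP[ga gb].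
apply: mem_full_gen; [lia | by apply: full_inner; lia | |].
  exact: (subsetP (H_Orth _ _)) ga.
move=> j ltj nj; have [aj|aj] := boolP (itv a b.-1 j); last exact: H_fixes ga.
by apply: H_fixes gb => //; move: nj aj; rewrite /itv; lia.
Qed.

Lemma path_generates_Orth : gen_by N rho predT = Orth.
Proof.
apply/group_inj/eqP; rewrite eqEsubset; apply/andP; split.
  by apply/gen_by_subP=> i lti _; apply: tv_Orth => //; apply: Qv.
apply/subsetP=> g gO; have : g \in H 0 N.
  apply: mem_full_gen => // [|j ltj]; first by apply: full_large; lia.
  by rewrite /itv ltj.
by move=> gH; apply: mem_gen_byS gH _.
Qed.

End Path.

(** * Symplectic frames and the existence of paths *)
Section Frames.
Variable m : nat.
Hypothesis dimV : n.-1.+1 = (2 * m)%N.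
Let N := (2 * m)%N.

Lemma B_sum (I : Type) (r : seq I) (P : pred I) (f : I -> V) y :
  B (\sum_(i <- r | P i) f i) y = \sum_(i <- r | P i) B (f i) y.
Proof. by elim/big_rec2: _ => [|k a b _ <-]; rewrite ?B0l ?BDl. Qed.

Lemma exists_nonperp x : x != 0 -> exists y, B x y != 0.
Proof.
move=> x0; apply/existsP; rewrite -negb_forall; apply: contra x0 => /forallP h.
by apply/eqP/Bnd => y; apply/eqP; apply: h.
Qed.

Lemma exists_perp r (s : nat -> V) : (r < N)%N ->
  exists2 x, x != 0 & forall i, (i < r)%N -> B x (s i) = 0.
Proof.
move=> ltr; pose C := \matrix_(k < n.-1.+1, i < r) B (delta_mx 0 k) (s i).
have /rowV0Pn[x /sub_kermxP xC x0] : kermx C != 0.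
  rewrite -mxrank_eq0 mxrank_ker subn_eq0 -ltnNge (leq_ltn_trans (rank_leq_col C)) //.
  by rewrite [X in (_ < X)%N]dimV.
exists x => // i lti; have /rowP/(_ (Ordinal lti)) := xC; rewrite !mxE => <-.
rewrite {1}(row_sum_delta x) B_sum; apply: eq_bigr => k _.
by rewrite BZl mxE.
Qed.

(** Up to the scalar c, a symplectic basis of a subspace. *)
Definition frame (c : F) k (E G : nat -> V) := forall i j, (i < k)%N -> (j < k)%N ->
  [/\ B (E i) (E j) = 0, B (G i) (G j) = 0 & B (E i) (G j) = if i == j then c else 0].

Definition perp_frame k (E G : nat -> V) x :=
  forall i, (i < k)%N -> B x (E i) = 0 /\ B x (G i) = 0.

Lemma perp_frame_linear k E G : linear_set (perp_frame k E G).
Proof.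
split=> [i _|a x y Px Py i lti]; first by rewrite !B0l.
by have [xE xG] := Px i lti; have [yE yG] := Py i lti; rewrite !BE xE xG yE yG mulr0 addr0.
Qed.

Section FrameSteps.
Variables (c : F) (k : nat) (E G : nat -> V).
Hypotheses (c0 : c != 0) (ltk : (k < m)%N) (fr : frame c k E G).

Lemma perp_frame_neq0 : exists2 x, x != 0 & perp_frame k E G x.
Proof.
clear fr c0; have [|x x0 xP] := @exists_perp (2 * k) (fun i => if (i < k)%N then E i else G (i - k)%N).
  by rewrite /N; lia.
exists x => // i lti; split.
  by have := xP i; rewrite lti; apply; lia.
by have := xP (i + k)%N; rewrite ifN ?addnK; [apply; lia | lia].
Qed.

(** Any x with B(e,x) <> 0 can be projected to the orthogonal of the frame without
   changing B(e,x). *)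
Lemma frame_mate e : e != 0 -> perp_frame k E G e ->
  exists2 f, perp_frame k E G f & B e f = c.
Proof.
move=> /exists_nonperp[x ex] Pe.
pose px := x + \sum_(i < k) c^-1 *: (B x (G i) *: E i + B x (E i) *: G i).
have Ppx : perp_frame k E G px.
  have sumE y i (lti : (i < k)%N) : 
      (forall j, (j < k)%N -> j != i -> B (E j) y = 0 /\ B (G j) y = 0) ->
      B px y = B x y + c^-1 * (B x (G i) * B (E i) y + B x (E i) * B (G i) y).
    move=> yP; rewrite /px BDl B_sum (bigD1 (Ordinal lti)) //= big1 ?addr0 => [|j ji].
      by rewrite !BE.
    by have [yE yG] := yP j (ltn_ord j) ji; rewrite !BE yE yG !mulr0 addr0 mulr0.
  move=> i lti; have [Eii Gii EGii] := fr lti lti; rewrite eqxx in EGii.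
  split; rewrite (sumE _ i lti) ?Eii ?Gii ?(Bsym (G i)) ?EGii.
  - by rewrite mulr0 add0r mulrA mulrAC mulVf // mul1r; ring: two0.
  - move=> j ltj ji; have [-> _ _] := fr ltj lti; have [_ _] := fr lti ltj.
    by rewrite Bsym eq_sym (negPf ji).
  - by rewrite mulr0 addr0 mulrA mulrAC mulVf // mul1r; ring: two0.
  move=> j ltj ji; have [_ -> ->] := fr ltj lti; by rewrite (negPf ji).
have Bepx : B e px = B e x.
  rewrite /px BDr [X in _ + X]Bsym B_sum big1 ?addr0 // => i _.
  by have [eE eG] := Pe i (ltn_ord i); rewrite Bsym !BE eE eG !mulr0 addr0 mulr0.
exists ((c / B e x) *: px); first exact: linear_setZ (perp_frame_linear _ _ _) Ppx.
by rewrite BZr Bepx divfK.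
Qed.

(** Not all of Q(e), Q(f) and Q(e+f) = Q(e) + Q(f) + c vanish. *)
Lemma perp_frame_nonsingular Q : quadratic_with_polar Q ->
  exists2 y, perp_frame k E G y & Q y != 0.
Proof.
move=> Qform; have [e e0 Pe] := perp_frame_neq0; have [f Pf ef] := frame_mate e0 Pe.
have [Qe|] := eqVneq (Q e) 0; last by exists e.
have [Qf|] := eqVneq (Q f) 0; last by exists f.
exists (e + f); first exact: linear_setD (perp_frame_linear _ _ _) _ _.
by rewrite (QD Qform) Qe Qf ef !add0r.
Qed.

Definition extend (f : nat -> V) x i := if i == k then x else f i.

Lemma frame_extend e f : perp_frame k E G e -> perp_frame k E G f -> B e f = c ->
  frame c k.+1 (extend E e) (extend G f).
Proof.
move=> Pe Pf ef i j; rewrite !ltnS /extend => lei lej.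
have lt_k l : (l <= k)%N -> (l == k) = false -> (l < k)%N.
  by move=> lel /eqP lk; rewrite ltn_neqAle lel andbT; apply/eqP.
case: (eqVneq i k) => [ik|/negPf ik]; case: (eqVneq j k) => [jk|/negPf jk].
- by rewrite !Balt ik jk eqxx.
- have [eE eG] := Pe j (lt_k j lej jk); have [fE fG] := Pf j (lt_k j lej jk).
  by rewrite eE eG fG ik eq_sym jk.
- have [eE eG] := Pe i (lt_k i lei ik); have [fE fG] := Pf i (lt_k i lei ik).
  by rewrite ![B _ e]Bsym ![B _ f]Bsym eE fE fG jk ik.
by apply: fr; apply: lt_k.
Qed.

End FrameSteps.

(** The values of Q on a pair are adjusted by adding multiples of a nonsingular vector
   orthogonal to the frame with this pair. No such vector is left for the last
   pair, whose values can only be kept away from two given scalars. *)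
Lemma exists_frame Q (c : F) (al be : nat -> F) :
    quadratic_with_polar Q -> c != 0 -> (0 < m)%N ->
  exists E G, [/\ frame c m E G,
    forall i, (i.+1 < m)%N -> Q (E i) = al i /\ Q (G i) = be i
    & Q (E m.-1) != al m.-1 /\ Q (G m.-1) != be m.-1].
Proof.
move=> Qform c0 m0.
have step k : (k < m)%N -> exists E G, frame c k E G /\
    (forall i, (i < k)%N -> Q (E i) = al i /\ Q (G i) = be i).
  elim: k => [|k IHk] ltk; first by exists (fun=> 0), (fun=> 0).
  have [E [G [fr QEG]]] := IHk (ltnW ltk).
  have [e e0 Pe] := perp_frame_neq0 E G (ltnW ltk).
  have [f Pf ef] := frame_mate c0 fr e0 Pe.
  have fr1 := frame_extend fr Pe Pf ef.
  have [y Py Qy] := perp_frame_nonsingular c0 ltk fr1 Qform.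
  have [ye yf] : B y e = 0 /\ B y f = 0.
    by have := Py k (ltnSn k); rewrite /extend eqxx.
  have Py' : perp_frame k E G y.
    by move=> i lti; have := Py i (ltnW lti); rewrite /extend ltn_eqF.
  have L := perp_frame_linear k E G.
  (* Square roots exist, so Q(z + s y) = Q(z) + s^2 Q(y) takes every value. *)
  have adjust z t : B y z = 0 -> exists s, Q (z + s *: y) = t.
    move=> yz; exists (char2_sqrt ch2 ((t + Q z) / Q y)).
    rewrite (QD Qform) (QZ Qform) BZr (Bsym z) yz char2_sqrtK divfK //; ring: two0.
  have [s Qs] := adjust e (al k) ye; have [t Qt] := adjust f (be k) yf.
  exists (extend k E (e + s *: y)), (extend k G (f + t *: y)); split.
    apply: frame_extend => //.
    - by apply: (linear_setD L) => //; apply: (linear_setZ _ L).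
    - by apply: (linear_setD L) => //; apply: (linear_setZ _ L).
    by rewrite !BE ef Balt ![B _ y]Bsym ye yf; ring.
  move=> i; rewrite ltnS leq_eqVlt /extend => /orP[/eqP->|lti]; first by rewrite eqxx.
  by rewrite ltn_eqF //; apply: QEG.
have ltm : (m.-1 < m)%N by rewrite (prednK m0).
have [E [G [fr QEG]]] := step m.-1 ltm.
have L := perp_frame_linear m.-1 E G.
have [y Py Qy] := perp_frame_nonsingular c0 ltm fr Qform.
have [l] : exists l : F, l \notin [:: 0; char2_sqrt ch2 (al m.-1 / Q y)].
  by apply: exists_notin; apply: leq_trans F4.
rewrite !inE negb_or => /andP[l0 lal].
pose e := l *: y; have Qe : Q e != al m.-1.
  apply: contraNneq lal => <-; apply/eqP/(sqr_inj ch2).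
  by rewrite /= char2_sqrtK /e (QZ Qform) mulfK.
have Qe0 : Q e != 0 by rewrite /e (QZ Qform) mulf_neq0 ?expf_neq0.
have e0 : e != 0.
  by apply: contraNneq Qe0 => ->; rewrite -(scale0r (0 : V)) (QZ Qform) expr0n mul0r.
have Pe : perp_frame m.-1 E G e by apply: (linear_setZ _ L).
have [f Pf ef] := frame_mate c0 fr e0 Pe.
have [t Qt] : exists t, Q (f + t *: e) != be m.-1.
  have [Qf|] := eqVneq (Q f) (be m.-1); last by exists 0; rewrite scale0r addr0.
  have [t] : exists t : F, t \notin [:: 0; c / Q e].
    by apply: exists_notin; apply: leq_trans F4.
  rewrite !inE negb_or => /andP[t0 te]; exists t.
  rewrite (QD Qform) (QZ Qform) BZr (Bsym f) ef Qf -addrA -subr_eq0 addrAC subrr add0r.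
  have -> : t ^+ 2 * Q e + t * c = t * (t * Q e + c) by ring.
  rewrite mulf_neq0 //; apply: contraNneq te => tc.
  by rewrite -[c]add0r -tc -[X in _ + X]oppF addrK mulfK.
exists (extend m.-1 E e), (extend m.-1 G (f + t *: e)).
have := @frame_extend c m.-1 E G fr e (f + t *: e) Pe.
rewrite (prednK m0) => fr'; split.
- apply: fr'; first by apply: (linear_setD L) => //; apply: (linear_setZ _ L).
  by rewrite BDr BZr Balt mulr0 addr0.
- by move=> i lti; rewrite /extend ltn_eqF; [apply: QEG; lia | lia].
by rewrite /extend eqxx.
Qed.

Lemma mul_form_mx r (s : 'I_r -> V) y i :
  (y *m (\matrix_(k < n.-1.+1, j < r) B (delta_mx 0 k) (s j))) 0 i = B y (s i).
Proof.
rewrite mxE {2}(row_sum_delta y) B_sum; apply: eq_bigr => k _.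
by rewrite BZl mxE.
Qed.

(** Orthogonality to u k links the coefficients of k - 1 and k + 1. Starting from
   the two ends, this kills the odd coefficients and the even ones, as N is even. *)
Lemma path_combination_eq0 u (x : nat -> F) : path_system N u ->
    (forall k, (k < N)%N -> \sum_(i < N) x i * B (u k) (u i) = 0) ->
  forall i, (i < N)%N -> x i = 0.
Proof.
move=> [far link] x0.
have neigh k k' : (k < N)%N -> (k' < N)%N -> (k' == k.+1) || (k == k'.+1) ->
    (forall i, (i < N)%N -> i != k' -> (i == k.+1) || (k == i.+1) -> x i = 0) -> x k' = 0.
  move=> ltk ltk' kk' xi0; have := x0 k ltk.
  rewrite (bigD1 (Ordinal ltk')) //= big1 ?addr0 => [|i /= ik'].
    have Bkk : B (u k) (u k') != 0.
      by case/orP: kk' ltk ltk' => /eqP-> *; [apply: link | rewrite Bsym; apply: link].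
    by move/eqP; rewrite mulf_eq0 (negPf Bkk) orbF => /eqP.
  have [near|nnear] := boolP (((i : nat) == k.+1) || (k == i.+1)).
    by rewrite xi0 ?mul0r.
  have lti := ltn_ord i.
  have [ik|ik|ik] := ltngtP i k; last by rewrite ik Balt mulr0.
    by rewrite Bsym far ?mulr0 //; move: nnear ik; clear; lia.
  by rewrite far ?mulr0 //; move: nnear ik; clear; lia.
have xodd a : (a.*2.+1 < N)%N -> x a.*2.+1 = 0.
  elim: a => [|a IHa] lta.
    apply: (neigh 0%N) => //; first exact: ltnW.
    by move=> i _ i1 ne; exfalso; move: i1 ne; clear; lia.
  apply: (neigh a.+1.*2) => //; [exact: ltnW | by rewrite eqxx |].
  move=> i lti ia ne; have -> : i = a.*2.+1 by move: ia ne; clear; lia.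
  by apply: IHa; lia.
have xeven a : (a.*2.+2 <= N)%N -> x (N - a.*2.+2)%N = 0.
  elim: a => [|a IHa] lea.
    apply: (neigh (N - 1)%N); [lia | lia | by apply/orP; right; lia |].
    by move=> i lti i1 ne; exfalso; move: lti i1 ne lea; clear; lia.
  apply: (neigh (N - a.+1.*2.+2).+1); [lia | lia | by rewrite eqxx orbT |].
  move=> i lti ia ne; have -> : i = (N - a.*2.+2)%N by move: ia ne lea lti; clear; lia.
  by apply: IHa; lia.
move=> i lti; have [oi|ei] := boolP (odd i).
  have -> : i = i./2.*2.+1 by rewrite -[LHS]odd_double_half oi.
  by apply: xodd; rewrite -[X in (X < _)%N]add1n -{1}[1%N]/(true : nat) -oi odd_double_half.
have eE := odd_double_half i; rewrite (negPf ei) add0n in eE.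
have -> : i = (N - (m - i./2.+1).*2.+2)%N by move: eE lti; rewrite /N; clear; lia.
by apply: xeven; move: eE lti; rewrite /N; clear; lia.
Qed.

Lemma path_dual u : path_system N u ->
  (exists w, dual_bases N u w) /\
  (forall x, (forall i, (i < N)%N -> B x (u i) = 0) -> x = 0).
Proof.
move=> pu; pose s (i : 'I_n.-1.+1) := u i.
pose C := \matrix_(k < n.-1.+1, j < n.-1.+1) B (delta_mx 0 k) (s j).
have Cu : C \in unitmx.
  rewrite -unitmx_tr -row_free_unit; apply: inj_row_free => x xC.
  have Cx : C *m x^T = 0 by rewrite -[C]trmxK -trmx_mul xC trmx0.
  pose x' i := x 0 (inord i).
  have x'0 : forall i, (i < N)%N -> x' i = 0.
    apply: (path_combination_eq0 pu) => k ltk.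
    have := congr1 (fun M => (u k *m M) 0 0) Cx; rewrite mulmx0 mulmxA !mxE => e.
    rewrite /N -dimV -[RHS]e; apply: eq_bigr => i _.
    by rewrite mul_form_mx mulrC /x' inord_val mxE.
  by apply/rowP=> i; rewrite mxE -[i]inord_val; apply: x'0; rewrite /N -dimV.
split.
  exists (fun j => delta_mx 0 (inord j) *m invmx C); split.
    move=> i j; rewrite /N -dimV => lti ltj.
    rewrite Bsym; have := mul_form_mx s (delta_mx 0 (inord j) *m invmx C) (inord i).
    rewrite mulmxKV // /s inordK // => <-; rewrite mxE eqxx /=.
    by rewrite -val_eqE /= !inordK.
  move=> x xw; apply: Bnd => z; rewrite Bsym.
  rewrite -[z](mulmxK Cu) (row_sum_delta (z *m C)) mulmx_suml B_sum big1 // => k _.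
  rewrite -scalemxAl BZl Bsym -[k]inord_val xw ?mulr0 //.
  by rewrite /N -dimV.
move=> x xu; have xC : x *m C = 0.
  by apply/rowP=> i; rewrite mul_form_mx mxE; apply: xu; rewrite /N -dimV.
by rewrite -[x](mulmxK Cu) xC mul0mx.
Qed.

(** path from a frame *)
(** The sequence G_0 + ... + G_{m-1}, E_0, G_0, E_0 + E_1, G_1, E_1 + E_2, G_2, ...,
   ending with E_{m-2} + E_{m-1}: a path with all its links equal to c. *)
Definition frame_path (E G : nat -> V) k :=
  if k == 0%N then \sum_(i < m) G i else
  if odd k then E k./2 + (if k./2 is a.+1 then E a else 0) else G k./2.-1.

Lemma frame_path_odd E G a :
  frame_path E G a.*2.+1 = E a + (if a is b.+1 then E b else 0).
Proof. by rewrite /frame_path /= odd_double /= uphalf_double. Qed.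

Lemma frame_path_even E G a : frame_path E G a.*2.+2 = G a.
Proof. by rewrite /frame_path /= odd_double /= doubleK. Qed.

Lemma frame_path_index k : [\/ k = 0%N, exists a, k = a.*2.+1 | exists a, k = a.*2.+2].
Proof.
case: k => [|k]; first by constructor.
have := odd_double_half k; case: (odd k) => /= <-.
  by apply: Or33; exists k./2.
by apply: Or32; exists k./2.
Qed.

Section FramePath.
Variables (c : F) (E G : nat -> V).
Hypotheses (c0 : c != 0) (fr : frame c m E G).
Local Notation u := (frame_path E G).

Lemma frame_sumE b : (b < m)%N -> B (\sum_(i < m) G i) (E b) = c.
Proof.
move=> ltb; rewrite B_sum (bigD1 (Ordinal ltb)) //= big1 ?addr0 => [|i ib].
  by have [_ _] := fr ltb ltb; rewrite eqxx Bsym.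
have [_ _] := fr ltb (ltn_ord i); rewrite Bsym => ->.
by rewrite ifN // eq_sym.
Qed.

Lemma frame_sumG b : (b < m)%N -> B (\sum_(i < m) G i) (G b) = 0.
Proof.
by move=> ltb; rewrite B_sum big1 // => i _; have [_ ->] := fr (ltn_ord i) ltb.
Qed.

Lemma frame_EG a b : (a < m)%N -> (b < m)%N -> B (E a) (G b) = if a == b then c else 0.
Proof. by move=> lta ltb; have [] := fr lta ltb. Qed.
Lemma frame_EE a b : (a < m)%N -> (b < m)%N -> B (E a) (E b) = 0.
Proof. by move=> lta ltb; have [] := fr lta ltb. Qed.
Lemma frame_GG a b : (a < m)%N -> (b < m)%N -> B (G a) (G b) = 0.
Proof. by move=> lta ltb; have [] := fr lta ltb. Qed.

Lemma frame_path_link i : (i.+1 < N)%N -> B (u i) (u i.+1) = c.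
Proof.
have [->|[a ->]|[a ->]] := frame_path_index i => lti.
- by rewrite -[1%N]/(0.*2.+1) frame_path_odd addr0 frame_sumE //; rewrite /N in lti; lia.
- have lta : (a < m)%N by rewrite /N in lti; lia.
  rewrite frame_path_odd frame_path_even BDl frame_EG // eqxx.
  case: a lta lti => [|b] ltb lti; first by rewrite B0l addr0.
  by rewrite frame_EG ?(ltnW ltb) // ltn_eqF ?addr0.
have lta : (a.+1 < m)%N by rewrite /N in lti; lia.
rewrite -doubleS frame_path_odd -[in X in B X _]/(a.*2.+2) frame_path_even BDr.
by rewrite ![B (G a) _]Bsym !frame_EG ?(ltnW lta) // eqxx gtn_eqF ?add0r.
Qed.

Lemma frame_path_far i j : (i < N)%N -> (j < N)%N -> (i.+1 < j)%N -> B (u i) (u j) = 0.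
Proof.
rewrite /N => lti; have [->|[b ->]|[b ->]] := frame_path_index j => // ltj.
  have ltb : (b < m)%N by lia.
  rewrite frame_path_odd; case: b ltb ltj => [|b] ltb ltj lij; first by lia.
  have ltb' := ltnW ltb.
  have [ei|[a ei]|[a ei]] := frame_path_index i; rewrite {}ei in lti lij *.
  - by rewrite /frame_path /= BDr !frame_sumE //; ring: two0.
  - have lta : (a < m)%N by lia.
    rewrite frame_path_odd BDl !BDr !frame_EE // add0r.
    case: a lti lij lta => [|a] lti lij lta; first by rewrite !B0l !addr0.
    by rewrite !frame_EE ?(ltnW lta) ?addr0.
  have lta : (a < m)%N by lia.
  rewrite frame_path_even BDr ![B (G a) _]Bsym !frame_EG //.
  by rewrite !ifN ?addr0 //; lia.
have ltb : (b < m)%N by lia.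
rewrite frame_path_even => lij.
have [ei|[a ei]|[a ei]] := frame_path_index i; rewrite {}ei in lti lij *.
- by rewrite /frame_path /= frame_sumG.
- have lta : (a < m)%N by lia.
  rewrite frame_path_odd BDl frame_EG // ifN; last by lia.
  rewrite add0r; case: a lti lij lta => [|a] lti lij lta; first by rewrite B0l.
  by rewrite frame_EG ?(ltnW lta) // ifN //; lia.
have lta : (a < m)%N by lia.
by rewrite frame_path_even frame_GG.
Qed.

Lemma frame_path_system : path_system N u.
Proof.
by split; [apply: frame_path_far | move=> i lti; rewrite frame_path_link].
Qed.

End FramePath.

Lemma Q_frame_sum Q c E G k : quadratic_with_polar Q -> frame c m E G -> (k <= m)%N ->
  Q (\sum_(i < k) G i) = \sum_(i < k) Q (G i).
Proof.
move=> Qform fr; elim: k => [|k IHk] lek.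
  by rewrite !big_ord0 -(scale0r (0 : V)) (QZ Qform) expr0n mul0r.
rewrite !big_ord_recr /= (QD Qform) IHk 1?ltnW // B_sum [X in _ + X = _]big1 ?addr0 // => i _.
by have [_ ->] := fr i k (ltn_trans (ltn_ord i) lek) lek.
Qed.

Lemma normalize1 Q x : Q x = 1 -> normalize Q x = x.
Proof.
move=> Qx; rewrite /normalize Qx; have -> : char2_sqrt ch2 1 = 1.
  by apply: (sqr_inj ch2); rewrite /= char2_sqrtK expr1n.
by rewrite invr1 scale1r.
Qed.

(** Take frame_path and scale its vectors to have value 1. The inner vectors already
   have value 1, and so keep the links c, if Q(G_i) = 1 and Q(E_i) alternates
   between 1 and 0. The end vectors only have to be nonsingular; this is a condition
   on the last pair of the frame that excludes one value for each of its members. *)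
Lemma exists_path Q c : quadratic_with_polar Q -> c != 0 -> (1 < m)%N ->
  exists v, [/\ path_system N v, forall i, (i < N)%N -> Q (v i) = 1
    & forall i, (0 < i)%N -> (i.+2 < N)%N -> B (v i) (v i.+1) = c].
Proof.
move=> Qform c0 m1; have m0 := ltnW m1.
pose al i : F := (if i == m.-1 then ~~ odd m.-2 else ~~ odd i)%:R.
pose be i : F := if i == m.-1 then m.-1%:R else 1.
have [E [G [fr QEG [QEl QGl]]]] := exists_frame al be Qform c0 m0.
pose u := frame_path E G; have [far _] := frame_path_system c0 fr.
have link : forall i, (i.+1 < N)%N -> B (u i) (u i.+1) = c by apply: frame_path_link.
have QE i : (i.+1 < m)%N -> Q (E i) = (~~ odd i)%:R.
  by move=> lti; have [-> _] := QEG i lti; rewrite /al ltn_eqF //; lia.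
have QG i : (i.+1 < m)%N -> Q (G i) = 1.
  by move=> lti; have [_ ->] := QEG i lti; rewrite /be ltn_eqF //; lia.
have QEE a : (a.+1 < m)%N -> Q (E a.+1 + E a) = Q (E a.+1) + Q (E a).
  by move=> lta; rewrite (QD Qform) (frame_EE fr) ?addr0 //; lia.
(* al and be prescribe the values for i < m - 1, and hold the values to be avoided
   for i = m - 1. *)
have Qinner i : (0 < i)%N -> (i.+1 < N)%N -> Q (u i) = 1.
  move=> i0 lti; have [ei|[a ei]|[a ei]] := frame_path_index i; rewrite {}ei in lti i0 *.
  - by [].
  - rewrite /u frame_path_odd; case: a lti i0 => [|a] lti _.
      by rewrite addr0 QE // /N in lti *; lia.
    rewrite /N in lti; rewrite QEE ?QE //=; try lia.
    by case: (odd a); rewrite ?addr0 ?add0r.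
  by rewrite /u frame_path_even QG //; rewrite /N in lti; lia.
have Qu i : (i < N)%N -> Q (u i) != 0.
  move=> lti; have [i0|i0] := posnP i.
    have sumQ k : k.+1 = m -> \sum_(i < m) Q (G i) = k%:R + Q (G k).
      move=> km; rewrite -[in LHS]km big_ord_recr /= (eq_bigr (fun=> 1)) => [|j _].
        by rewrite sumr_const card_ord.
      by apply: QG; rewrite -km ltnS.
    rewrite i0 /u /frame_path /= (Q_frame_sum Qform fr) // (sumQ m.-1 (prednK m0)).
    apply: contraNneq QGl => e; apply/eqP.
    by rewrite /be eqxx -[LHS]add0r -e; ring: two0.
  have [lti1|] := ltnP i.+1 N; first by rewrite Qinner // oner_neq0.
  move=> leN; have -> : i = m.-1.*2.+1 by rewrite /N in lti leN; lia.
  rewrite /u frame_path_odd; have em : m.-1 = m.-2.+1 by lia.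
  rewrite em QEE; last by lia.
  rewrite -em; apply: contraNneq QEl => e; rewrite /al eqxx -QE; last by lia.
  by rewrite -[Q _]addr0 -e; apply/eqP; ring: two0.
exists (fun i => normalize Q (u i)); split.
- split=> [i j lti ltj ltij|i lti]; rewrite /normalize BZl BZr.
    by rewrite far ?mulr0.
  by rewrite link // !mulf_neq0 ?invr_eq0 ?char2_sqrt_eq0 ?Qu //; exact: ltnW.
- by move=> i lti; apply: Q_normalize => //; apply: Qu.
by move=> i i0 lti; rewrite !normalize1 ?link ?Qinner //; lia.
Qed.

(** * Orthogonal and symplectic groups *)
Theorem orthogonal_string_C_group Q k : quadratic_with_polar Q -> (1 < m)%N ->
  (3 <= k <= N)%N -> is_string_C_group_of_rank (orthogonal_group Q) k.
Proof.
move=> Qform m1 leN; have [c cgood] := exists_good_parameter ch2 F4.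
have [c0 _ _] := cgood.
have [v [vpath Qv vgood]] := exists_path Qform c0 m1.
have [[w dual] _] := path_dual vpath.
have N4 : (3 < N)%N by rewrite /N; lia.
have lS : linked_string N (tv \o v).
  apply: tv_linked_string => // [i lti|].
    apply: contraTneq isT => vi0; have := Qv i lti.
    by rewrite vi0 -(scale0r (0 : V)) (QZ Qform) expr0n mul0r => /eqP; rewrite eq_sym oner_eq0.
  exact: (path_interval_property Qform N4 dual cgood).
have [r rS genr] := rank_reduction lS leN.
apply: (linked_string_C_group rS); rewrite genr.
exact: (path_generates_Orth Qform N4 dual cgood).
Qed.

Lemma quadratic_add_square Q y : quadratic_with_polar Q ->
  quadratic_with_polar (fun x => Q x + B x y ^+ 2).
Proof.
move=> Qform; split=> [a x|x x']; first by rewrite (QZ Qform) BZl; ring.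
by rewrite (QD Qform) BDl; ring: two0.
Qed.

(** B is the sum of a triangular bilinear form b and its transpose; take b(x,x). *)
Lemma exists_quadratic_form : exists Q, quadratic_with_polar Q.
Proof.
pose e (i : 'I_n.-1.+1) : V := delta_mx 0 i.
pose U := \matrix_(i, j) (if (i < j)%N then B (e i) (e j) else 0).
have BU x y : B x y = (x *m (U + U^T) *m y^T) 0 0.
  have -> : U + U^T = \matrix_(i, j) B (e i) (e j).
    apply/matrixP=> i j; rewrite !mxE; case: (ltngtP i j) => ij.
    - by rewrite addr0.
    - by rewrite add0r Bsym.
    by rewrite addr0 (val_inj ij) Balt.
  rewrite mxE {1}(row_sum_delta y) Bsym B_sum; apply: eq_bigr => k _.
  by rewrite mul_form_mx BZl Bsym [y^T _ _]mxE mulrC.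
pose b (x y : V) : F := (x *m U *m y^T) 0 0.
have bDl x x' y : b (x + x') y = b x y + b x' y by rewrite /b !mulmxDl mxE.
have bDr x y y' : b x (y + y') = b x y + b x y' by rewrite /b linearD mulmxDr mxE.
have Bb x y : B x y = b x y + b y x.
  rewrite BU mulmxDr mulmxDl mxE; congr (_ + _).
  have -> : x *m U^T *m y^T = (y *m U *m x^T)^T by rewrite !trmx_mul trmxK mulmxA.
  by rewrite mxE.
exists (fun x => b x x); split=> [a x|x y]; last by rewrite Bb bDl !bDr; ring.
by rewrite /b linearZ /= -!scalemxAl -scalemxAr !mxE mulrA -expr2.
Qed.

(** Here Q may be chosen after the path: adding the square of a linear form B(.,y) to
   a form with polar B allows arbitrary values on a basis. *)
Lemma exists_uniform_path c : c != 0 -> (1 < m)%N -> exists Q v,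
  [/\ quadratic_with_polar Q, path_system N v,
      forall i, (i < N)%N -> Q (v i) = 1
    & forall i, (i.+1 < N)%N -> B (v i) (v i.+1) = c].
Proof.
move=> c0 m1; have [Q0 Q0form] := exists_quadratic_form.
have [E [G [fr _ _]]] := exists_frame (fun=> 0) (fun=> 0) Q0form c0 (ltnW m1).
have vpath := frame_path_system c0 fr; set v := frame_path E G in vpath.
have [[w dual] _] := path_dual vpath.
pose y := \sum_(i < N) char2_sqrt ch2 (1 + Q0 (v i)) *: w i.
have By i : (i < N)%N -> B (v i) y = char2_sqrt ch2 (1 + Q0 (v i)).
  move=> lti; rewrite Bsym B_sum (bigD1 (Ordinal lti)) //= big1 ?addr0 => [|j ji].
    by rewrite BZl Bsym (dualE dual) // eqxx mulr1.
  rewrite BZl Bsym (dualE dual) // (_ : (i == j) = false) ?mulr0 //.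
  by apply: negbTE; rewrite eq_sym.
exists (fun x => Q0 x + B x y ^+ 2), v; split=> //.
- exact: quadratic_add_square.
- by move=> i lti; rewrite By // char2_sqrtK; ring: two0.
exact: frame_path_link.
Qed.

Section SymplecticGeneration.
Variables (Q : V -> F) (z : V).
Hypotheses (Qform : quadratic_with_polar Q) (m1 : (1 < m)%N) (z0 : z != 0).
Let Q' x := Q x + B x z ^+ 2.

(** It amounts to B(x',z)^2 = 1 + Q(x); the value of Q is then adjusted by a
   nonsingular vector orthogonal to z and to a vector y1 with B(z,y1) = 1. *)
Lemma meets_both_forms x : Q x != 1 -> x != 0 ->
  exists2 x', Q x' = Q x & Q' x' = 1.
Proof.
move=> Qx x0; pose e := char2_sqrt ch2 (1 + Q x).
have e0 : e != 0.
  rewrite char2_sqrt_eq0; apply: contraNneq Qx => Qx1; apply/eqP.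
  by rewrite -[LHS]add0r -Qx1; ring: two0.
have [y zy] := exists_nonperp z0; pose y1 := (B z y)^-1 *: y.
have zy1 : B z y1 = 1 by rewrite BZr mulVf.
have fr : frame 1 1 (fun=> z) (fun=> y1).
  by move=> [|i] [|j] // _ _; rewrite !Balt zy1.
have [t Pt Qt] := perp_frame_nonsingular (oner_neq0 F) m1 fr Qform.
have [tz ty] : B t z = 0 /\ B t y1 = 0 by apply: (Pt 0%N).
pose s := char2_sqrt ch2 ((Q (e *: y1) + Q x) / Q t).
have Qx' : Q (e *: y1 + s *: t) = Q x.
  by rewrite (QD Qform) (QZ Qform s) BZl BZr (Bsym y1) ty char2_sqrtK divfK //; ring: two0.
exists (e *: y1 + s *: t) => //.
rewrite /Q' Qx' BDl (BZl e) (BZl s) (Bsym y1) zy1 tz mulr0 addr0 mulr1 char2_sqrtK; ring: two0.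
Qed.

Lemma symplectic_generated (K : {group GL}) : orthogonal_group Q \subset K ->
  orthogonal_group Q' \subset K -> K \subset Sp -> Sp \subset K.
Proof.
move=> sQK sQ'K sKS.
have Q'form : quadratic_with_polar Q' by apply: quadratic_add_square.
have tvK x : tv x \in K.
  have [->|x0] := eqVneq x 0.
    have -> : tv 0 = 1%g by apply: ap_inj => y; rewrite tvE ap1 scaler0 addr0.
    exact: group1.
  have [Qx|Qx] := eqVneq (Q x) 1; first by apply: (subsetP sQK); apply: tv_Orth.
  have [x' Qx' Q'x'] := meets_both_forms Qx x0.
  have x'0 : x' != 0.
    apply: contraTneq isT => x'0; move: Q'x'.
    by rewrite x'0 -(scale0r (0 : V)) (QZ Q'form) expr0n mul0r => /eqP; rewrite eq_sym oner_eq0.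
  pose A (_ : V) := True.
  have [||||||g gA xg] := @reflection_transitive Q Qform A x (x + x').
  - by [].
  - by have [y] := exists_nonperp x0; exists y.
  - by rewrite addvK; have [y] := exists_nonperp x'0; exists y.
  - have [||y _ Qy] := @perp_frame_nonsingular 1 0 (fun=> 0) (fun=> 0) (oner_neq0 F) _ _ Q Qform.
    + exact: ltnW.
    + by [].
    by exists y.
  - by [].
  - by rewrite addvK.
  have gK : g \in K.
    by apply: gA => y _ Qy; apply: (subsetP sQK); apply: tv_Orth.
  rewrite -(tvJ_mem x sKS gK) xg addvK.
  by apply: (subsetP sQ'K); apply: tv_Orth.
have [Q1 [v [_ vpath _ _]]] := exists_uniform_path (oner_neq0 F) m1.
have [[w dual] _] := path_dual vpath.
apply/subsetP=> g gS.
have gen : generated_by (supported N w 0 N) (fun _ => True) g.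
  apply: (generated_of_fixes dual (Gam := Sp)) => //.
  - by move=> x _; apply: tv_Sp.
  - move=> A x u Al xA xuA _ Au _; exact: transvection_transitive.
  by move=> j ltj; rewrite /itv ltj.
by apply: gen.
Qed.

End SymplecticGeneration.

Theorem symplectic_string_C_group k : (1 < m)%N ->
  (3 <= k <= N.+1)%N -> is_string_C_group_of_rank Sp k.
Proof.
move=> m1 leN; have [c cgood] := exists_good_parameter ch2 F4.
have [c0 _ _] := cgood.
have N4 : (3 < N)%N by rewrite /N; nlia.
have [Q [u [Qform upath Qu ulink]]] := exists_uniform_path c0 m1.
have [[w dual] _] := path_dual upath; have [ufar _] := upath.
have ltN1 : (N.-1 < N)%N by nlia.
have lt0N : (0 < N)%N by nlia.
pose p := w N.-1.
(* The scalar l is chosen so that Q(l p) <> 1; otherwise z would be 0. *)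
have [l] : exists l : F, l \notin [:: 0; char2_sqrt ch2 (Q p)^-1].
  by apply: exists_notin; apply: leq_trans F4.
rewrite !inE negb_or => /andP[l0 lQ].
have Qlp : Q (l *: p) != 1.
  apply: contraNneq lQ; rewrite (QZ Qform) => lp; apply/eqP/(sqr_inj ch2).
  rewrite /= char2_sqrtK; have Qp0 : Q p != 0 by apply: contra_eq_neq lp => ->; rewrite mulr0 eq_sym oner_eq0.
  by rewrite -[LHS]mulr1 -(divff Qp0) mulrA lp mul1r.
pose v i := if (i < N)%N then u i else l *: p.
have vu i : (i < N)%N -> v i = u i by rewrite /v => ->.
have vN : v N = l *: p by rewrite /v ltnn.
have Bup i : (i < N)%N -> B (u i) (l *: p) = if i == N.-1 then l else 0.
  by move=> lti; rewrite BZr (dualE dual) //; case: eqP; rewrite ?mulr1 ?mulr0.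
have vpath : path_system N.+1 v.
  split=> [i j lti ltj ltij|i lti].
    have ltiN : (i < N)%N by nlia.
    rewrite (vu i) //; have [ltjN|leNj] := ltnP j N; first by rewrite vu // ufar.
    have -> : j = N by nlia.
    by rewrite vN Bup // ifN //; nlia.
  have ltiN : (i < N)%N by nlia.
  rewrite (vu i) //; have [ltjN|leNj] := ltnP i.+1 N; first by rewrite vu // ulink.
  have ei : i.+1 = N by nlia.
  by rewrite ei vN Bup // -ei eqxx.
pose v1 i := v i.+1.
have v1path : path_system N v1.
  by case: vpath => far link; split=> [i j *|i *]; [apply: far | apply: link].
have [[w1 dual1] v1perp] := path_dual v1path.
pose ka := B (v N) (w 0%N).
(* Otherwise w 0 would be orthogonal to v 1, ..., v N, which is a basis. *)
have ka0 : ka != 0.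
  apply/eqP=> ka0; have := dualE dual lt0N lt0N; rewrite eqxx.
  suff -> : w 0%N = 0 by rewrite B0r => /eqP; rewrite eq_sym oner_eq0.
  apply: v1perp => i lti; rewrite Bsym /v1.
  have [ltiN|leNi] := ltnP i.+1 N; first by rewrite vu // (dualE dual).
  by have -> : i.+1 = N by nlia.
pose mu := char2_sqrt ch2 (1 + Q (v N)) / ka.
have mu0 : mu != 0.
  rewrite mulf_neq0 ?invr_eq0 // char2_sqrt_eq0 vN; apply: contraNneq Qlp => e; apply/eqP.
  by rewrite -[LHS]add0r -e; ring: two0.
pose z := mu *: w 0%N.
have w00 : w 0%N != 0.
  apply/eqP=> w00; have := dualE dual lt0N lt0N.
  by rewrite w00 B0r eqxx => /eqP; rewrite eq_sym oner_eq0.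
have z0 : z != 0 by rewrite scaler_eq0 negb_or mu0.
pose Q' x := Q x + B x z ^+ 2.
have Q'form : quadratic_with_polar Q' by apply: quadratic_add_square.
have Q'v1 i : (i < N)%N -> Q' (v1 i) = 1.
  move=> lti; rewrite /Q' /v1 BZr.
  have [ltiN|leNi] := ltnP i.+1 N.
    by rewrite vu // (dualE dual) // mulr0 expr0n addr0 Qu.
  have -> : i.+1 = N by nlia.
  by rewrite -/ka /mu divfK // char2_sqrtK; ring: two0.
have ugood i : (0 < i)%N -> (i.+2 < N)%N -> B (u i) (u i.+1) = c.
  by move=> _ lti; apply: ulink; apply: ltnW.
have v1good i : (0 < i)%N -> (i.+2 < N)%N -> B (v1 i) (v1 i.+1) = c.
  by move=> _ lti; rewrite /v1 !vu ?ulink // ltnW.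
pose r i := tv (v i).
have sub_Orth M (P : pred nat) (x : nat -> V) (q : V -> F) : quadratic_with_polar q ->
    (forall i, (i < M)%N -> P i -> q (x i) = 1) ->
    gen_by M (fun i => tv (x i)) P \subset orthogonal_group q.
  by move=> qform qx; apply/gen_by_subP=> i lti Pi; apply: tv_Orth => //; apply: qx.
have lowE a b : (b <= N)%N -> gen_by N.+1 r (itv a b) = gen_by N (tv \o u) (itv a b).
  move=> leb; rewrite (gen_by_widen (M := N)) //; last by move=> i _; rewrite /itv; nlia.
  by apply: eq_gen_by => // i lti _; rewrite /r vu.
have highE a b : (0 < a)%N -> gen_by N.+1 r (itv a b) = gen_by N (tv \o v1) (itv a.-1 b.-1).
  exact: gen_by_shift.
have ipr : interval_property N.+1 r.
  move=> a b leabN; have [leb|ltb] := leqP b N.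
    rewrite !lowE //; try nlia.
    by apply: (path_interval_property Qform N4 dual cgood upath Qu ugood); nlia.
  have [a0|a0] := posnP a; last first.
    rewrite !highE // -[X in gen_by _ _ (itv X _) :&: _]/(a.-1) /=.
    have := @path_interval_property Q' Q'form N v1 w1 c N4 dual1 cgood v1path Q'v1 v1good a.-1 b.-1.
    by rewrite (prednK a0); apply; nlia.
  (* For the whole interval, g is in O(Q) and O(Q'), so it fixes z. *)
  have {ltb leabN}-> : b = N.+1 by nlia.
  rewrite a0 /= [in X in _ \subset X]lowE //; apply/subsetP=> g /setIP[g1 g2].
  have gQ : g \in orthogonal_group Q.
    rewrite lowE // in g1; apply: subsetP g1; apply: (@sub_Orth N _ u Q) => //.
    by move=> i lti _; apply: Qu.
  have gQ' : g \in orthogonal_group Q'.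
    rewrite highE // in g2; apply: subsetP g2; apply: (@sub_Orth N _ v1 Q') => //.
    by move=> i lti _; apply: Q'v1.
  apply: (mem_full_gen Qform dual Qu) => //.
    by apply: (full_large Qform N4 dual cgood upath Qu ugood); nlia.
  move=> j ltj nj; have -> : j = 0%N by move: nj; rewrite /itv; nlia.
  have gS := SpP _ (subsetP (Orth_Sp Qform) _ gQ).
  have zg : ap z g = z.
    apply/eqP; rewrite -subr_eq0 oppv; apply/eqP/Bnd => y; rewrite -(apVK g y).
    set x := ap y _; rewrite BDl gS.
    have := OrthP _ _ gQ' x; rewrite /Q' (OrthP _ _ gQ x) => /addrI/(sqr_inj ch2).
    by rewrite ![B _ z]Bsym => ->; ring: two0.
  have -> : w 0%N = mu^-1 *: z by rewrite scalerA mulVf // scale1r.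
  by rewrite apZ zg.
have lS : linked_string N.+1 r.
  apply: tv_linked_string => // i lti; have [ltiN|leNi] := ltnP i N.
    rewrite vu //; apply: contraTneq isT => vi0; have := Qu i ltiN.
    by rewrite vi0 -(scale0r (0 : V)) (QZ Qform) expr0n mul0r => /eqP; rewrite eq_sym oner_eq0.
  have -> : i = N by nlia.
  by apply: contraNneq ka0 => e; rewrite /ka e B0l.
have [r' r'S genr] := rank_reduction lS leN.
apply: (linked_string_C_group r'S); rewrite genr.
have sKS : gen_by N.+1 r predT \subset Sp by apply/gen_by_subP=> i _ _; apply: tv_Sp.
apply/group_inj/eqP; rewrite eqEsubset sKS /=.
apply: (symplectic_generated Qform m1 z0) => //.
  rewrite -(path_generates_Orth Qform N4 dual cgood upath Qu ugood).
  apply/gen_by_subP=> i lti _; rewrite -vu //; apply: (mem_gen_by r) => //; exact: ltnW.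
rewrite -(path_generates_Orth Q'form N4 dual1 cgood v1path Q'v1 v1good).
by apply/gen_by_subP=> i lti _; apply: (mem_gen_by r).
Qed.

End Frames.

End Transvections.

Lemma hermitian_alternating (F : finFieldType) (n : nat) (eps : bool)
    (B : {hermitian 'rV[F]_n.-1.+1 for eps & idfun}) : 2 \in [pchar F] ->
  nondegenerate B -> (forall v, B v v = 0) -> nondegenerate_alternating B.
Proof.
move=> ch2 Bnd Balt; split=> //.
- by move=> a u v w; rewrite linearPl.
- have sgn (b : bool) : (-1) ^+ b = 1 :> F.
    by case: b; rewrite ?expr1 ?expr0 ?(oppr_pchar2 ch2).
  by move=> u v; rewrite hermC sgn mul1r.
move=> u Bu; apply/eqP; rewrite -memv0; move/eqP: Bnd => <-.
by apply/mem_orthovP=> v _; apply: Bu.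
Qed.

Lemma polar_alternating (F : finFieldType) (n : nat) (Q : 'rV[F]_n.-1.+1 -> F) :
    2 \in [pchar F] -> is_quadratic_form Q -> polar_nondegenerate Q ->
  exists2 B, nondegenerate_alternating B & quadratic_with_polar B Q.
Proof.
move=> ch2 [Qscale _] [B polB Bnd]; have oppF := oppr_pchar2 ch2.
have QB u v : Q (u + v) = Q u + Q v + B u v by rewrite -polB /polar; ring.
exists B; last by split.
apply: hermitian_alternating => // v; rewrite -polB /polar -mulr2n -scaler_nat.
by rewrite (pcharf0 ch2) Qscale expr0n mul0r sub0r !oppF (addrr_pchar2 ch2).
Qed.

Theorem theorem1p4 (k m : nat) (F : finFieldType)
    (hk : (2 <= k)%N) (hm : (2 <= m)%N) (hF : #|F| = (2 ^ k)%N) :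
  [/\ (* Sp(2m, F) *)
      forall B : {skew_symmetric 'rV[F]_(2 * m)%N.-1.+1},
        nondegenerate B -> (forall v, B v v = 0) ->
        forall n : nat, (3 <= n <= 2 * m + 1)%N ->
          is_string_C_group_of_rank
            (bilinear_isometries_group (n := (2 * m)%N) B) n,
      (* O^+(2m, F) *)
      forall Q : 'rV[F]_(2 * m)%N.-1.+1 -> F,
        is_quadratic_form Q -> polar_nondegenerate Q -> witt_index Q = m ->
        forall n : nat, (3 <= n <= 2 * m)%N ->
          is_string_C_group_of_rank
            (quadratic_isometries_group (n := (2 * m)%N) Q) n
    & (* O^-(2m, F) *)
      forall Q : 'rV[F]_(2 * m)%N.-1.+1 -> F,
        is_quadratic_form Q -> polar_nondegenerate Q ->
        witt_index Q = (m - 1)%N ->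
        forall n : nat, (3 <= n <= 2 * m)%N ->
          is_string_C_group_of_rank
            (quadratic_isometries_group (n := (2 * m)%N) Q) n].
Proof.
have ch2 : 2 \in [pchar F] := card_finPcharP hF isT.
have F4 : (3 < #|F|)%N by rewrite hF -[4%N]/(2 ^ 2)%N leq_exp2l.
have dimV : (2 * m)%N.-1.+1 = (2 * m)%N by rewrite prednK // muln_gt0 (ltnW hm).
have orth (Q : 'rV[F]_(2 * m)%N.-1.+1 -> F) n : is_quadratic_form Q ->
    polar_nondegenerate Q -> (3 <= n <= 2 * m)%N ->
    is_string_C_group_of_rank (quadratic_isometries_group (n := (2 * m)%N) Q) n.
  move=> Qquad Qnd len; have [B Bform Qform] := polar_alternating ch2 Qquad Qnd.
  exact: (orthogonal_string_C_group ch2 F4 Bform dimV Qform hm len).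
split=> [B Bnd Balt n | Q Qquad Qnd _ n len | Q Qquad Qnd _ n len]; try exact: orth.
rewrite addn1 => len.
have Bform := hermitian_alternating ch2 Bnd Balt.
exact: (symplectic_string_C_group ch2 F4 Bform dimV hm len).
Qed.
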